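(* Let $\Omega \subseteq \mathbb{C}$ be an open set, $F \subseteq \mathbb{N}_0$ be a non-empty set and $l \in \mathbb{N}_0$. Then, either for every $f \in H_{F}^{\infty}(\Omega)$ the derivative $f^{(l)}$ is bounded on $\Omega$, or generically for every $f \in H_{F}^{\infty}(\Omega)$ the derivative $f^{(l)}$ is unbounded on $\Omega$.
   Context: $\mathbb{N}_0=\{0,1,2,\dots\}$. For an open set $\Omega\subseteq\mathbb{C}$, $H(\Omega)$ is the set of holomorphic functions on $\Omega$. For non-empty $F\subseteq\mathbb{N}_0$, $H_F^\infty(\Omega)=\{f\in H(\Omega): f^{(k)} \text{ is bounded on } \Omega \text{ for all } k\in F\}$. Let $\Omega_i$, $i\in I$ ($I$ finite or $I=\mathbb{N}$), be the connected components of $\Omega$ and fix a point $z_i\in\Omega_i$ for each $i\in I$. The natural topology of $H_F^\infty(\Omega)$ is the one induced by the seminorms $\sup_{z\in\Omega}|f^{(k)}(z)|$, $k\in F$, and $|f^{(k)}(z_i)|$, $0\leqslant k<\min F$, $i\in I$; with it, $H_F^\infty(\Omega)$ is a Fréchet space. A property holds ''generically for every $f\in H_F^\infty(\Omega)$'' if the set of $f$ having the property contains a dense $G_\delta$ subset of $H_F^\infty(\Omega)$. *)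

(* Defs.v *)
From HB Require Import structures.
From mathcomp Require Import all_boot all_order all_algebra.
From mathcomp Require Import complex.
From mathcomp Require Import all_classical all_reals all_analysis borel_hierarchy.
Set Implicit Arguments.
Unset Strict Implicit.
Unset Printing Implicit Defensive.
Import Order.TTheory GRing.Theory Num.Theory.
Import numFieldNormedType.Exports.
Local Open Scope classical_set_scope.
Local Open Scope ring_scope.

(* The topology, norm and complex derivative on R[i] come from the generic
   instances on numFieldType; they are only found when R[i] is presented as
   the sort of a bundled structure. *)
Definition Cplx (R : realType) : numClosedFieldType := R[i].

Definition cmod (R : realType) (w : Cplx R) : R := ComplexField.Normc.normc w.

Definition holomorphic_on (R : realType) (Omega : set (Cplx R))
    (f : Cplx R -> Cplx R) : Prop :=
  forall w, Omega w -> derivable f w 1.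

(* A function on Omega is represented by its extension by 0 to the whole plane,
   so that equality of elements is equality of functions on Omega. As Omega is
   open, the values of derive1n k f on Omega do not depend on this extension. *)
Definition HFinfty_set (R : realType) (Omega : set (Cplx R)) (F : set nat) :
    set (Cplx R -> Cplx R) :=
  [set f | [/\ holomorphic_on Omega f,
               forall w, ~ Omega w -> f w = 0 &
               forall k, F k -> [bounded derive1n k f w | w in Omega]]].

(* I enumerates, without repetition, the connected components of Omega
   as the sets Omega_ i. *)
Definition components_indexed (R : realType) (Omega : set (Cplx R))
    (I : set nat) (Omega_ : nat -> set (Cplx R)) : Prop :=
  [/\ finite_set I \/ I = [set: nat],
      set_inj I Omega_ &
      Omega_ @` I = [set connected_component Omega w | w in Omega]].

Definition sup_seminorm (R : realType) (Omega : set (Cplx R)) (k : nat)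
    (f : Cplx R -> Cplx R) : R :=
  sup [set cmod (derive1n k f w) | w in Omega].

Definition point_seminorm (R : realType) (w : Cplx R) (k : nat)
    (f : Cplx R -> Cplx R) : R :=
  cmod (derive1n k f w).

(* The condition on k in the second family is k < min F. *)
Definition HFinfty_seminorms (R : realType) (Omega : set (Cplx R))
    (F I : set nat) (z : nat -> Cplx R) : set ((Cplx R -> Cplx R) -> R) :=
  [set p | (exists2 k, F k & p = sup_seminorm Omega k) \/
           (exists i k, [/\ I i, forall j, F j -> (k < j)%N &
                            p = point_seminorm (z i) k])].

(* The base points (z i), i in I, are parameters of the type because its
   topology is defined from them. *)
Definition HFinfty (R : realType) (Omega : set (Cplx R)) (F I : set nat)
    (z : nat -> Cplx R) : Type :=
  {f : Cplx R -> Cplx R | HFinfty_set Omega F f}.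

Section HFinfty_topology.
Context (R : realType) (Omega : set (Cplx R)) (F I : set nat)
  (z : nat -> Cplx R).
Local Notation H := (HFinfty Omega F I z).

Definition HFinfty_fun (f : H) : Cplx R -> Cplx R := proj1_sig f.

Definition HFinfty_open : set_system H :=
  [set U | forall f, U f ->
    exists (S : set ((Cplx R -> Cplx R) -> R)) (e : R),
      [/\ finite_set S, S `<=` HFinfty_seminorms Omega F I z, 0 < e &
          forall g : H,
            (forall p, S p -> p (HFinfty_fun g \- HFinfty_fun f) < e) -> U g]].

Let openT : HFinfty_open setT.
Proof. by move=> f _; exists set0, 1; split => //. Qed.

Let openI : setI_closed HFinfty_open.
Proof.
move=> A B oA oB f [/oA[S [d [fS sS d0 SA]]] /oB[T [e [fT sT e0 TB]]]].
exists (S `|` T), (Order.min d e); split.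
- by rewrite finite_setU.
- by rewrite subUset.
- by rewrite lt_min d0.
- move=> g gST; split.
  + by apply: SA => p Sp; have := gST p (or_introl Sp); rewrite lt_min => /andP[].
  + by apply: TB => p Tp; have := gST p (or_intror Tp); rewrite lt_min => /andP[].
Qed.

Let open_bigU (J : Type) (U : J -> set H) :
  (forall j, HFinfty_open (U j)) -> HFinfty_open (\bigcup_j U j).
Proof.
move=> oU f [j _ /oU[S [e [fS sS e0 SU]]]].
by exists S, e; split => // g /SU; exists j.
Qed.

HB.instance Definition _ := gen_eqMixin H.
HB.instance Definition _ := gen_choiceMixin H.
HB.instance Definition _ := isOpenTopological.Build H openT openI open_bigU.

End HFinfty_topology.

Definition generically (T : topologicalType) (P : T -> Prop) : Prop :=
  exists G : set T, [/\ Gdelta G, dense G & forall f, G f -> P f].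

(* Main.v *)
Require Import Defs.
From HB Require Import structures.
From mathcomp Require Import all_boot all_order all_algebra.
From mathcomp Require Import complex.
From mathcomp Require Import all_classical all_reals all_analysis borel_hierarchy.
From mathcomp Require Import ring lra.
Set Implicit Arguments.
Unset Strict Implicit.
Unset Printing Implicit Defensive.
Import Order.TTheory GRing.Theory Num.Theory.
Import numFieldNormedType.Exports.
Local Open Scope classical_set_scope.
Local Open Scope ring_scope.

(* If some f in the space has f^(l) unbounded, the set U of all such f is itself
   a dense G_delta. It is dense because its complement is a proper linear
   subspace, and it is the intersection over n of the sets
   {f : |f^(l)(w)| > n for some w in Omega}, which are open as soon as every
   evaluation f |-> f^(l)(w) is continuous. Let m = min F. For l >= m this
   continuity follows from sup |f^(m)| by Cauchy's estimates. For l < m one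
   descends from l + 1 to l: by the mean value inequality the set of w at which
   the evaluation is continuous is open and closed in each component, and it
   contains the base point.
   Cauchy's estimates come from the integral formula on squares, that is, from
   Goursat's theorem for the difference quotient of f at a point p. The integral
   of dz / (z - p) along the square does not depend on p near the center, and
   need not be computed: it suffices that its imaginary part is at least 4. *)

(** The difficulty is uniformity. Cauchy's estimate for [f^(k+1)] at [z] consumes a bound on [f^(k)]
    over a whole square around [z], so continuity of each single evaluation would not pass to the
    next order. The inductions therefore carry [eval_equicontinuous]: one finite set of seminorms
    and one constant for a whole disc. Below [m] the point seminorms see only the base points and
    supply just the pointwise notion [eval_continuous]; it becomes uniform again once the next
    derivative is controlled on a disc. Goursat's theorem is wanted with an exceptional point
    because the difference quotient of [f] at [p] is only known to be continuous at [p]. The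
    integral formula is then differentiated twice under the integral sign: the first derivative
    gives the estimate, the second shows that [f'] is again holomorphic, which every statement about
    higher derivatives presupposes. Only continuity is at stake, so no constant is sharp. *)

Section ComplexNorm.
Context {R : realType}.
Implicit Types (w z d k : Cplx R) (f g : Cplx R -> Cplx R) (r e : R).

(** The norm of the generic instance takes values in [Cplx R] itself. Passing to the real number
    [cmod w] makes suprema, the total order and [lra] available. *)
Lemma normE w : `|w| = Complex (cmod w) 0.
Proof. by rewrite normc_def; case: w. Qed.

Lemma cmod_ge0 w : 0 <= cmod w.
Proof. by case: w => a b; exact: sqrtr_ge0. Qed.

Lemma cmodM w z : cmod (w * z) = cmod w * cmod z.
Proof. exact: ComplexField.Normc.normcM. Qed.

Lemma cmodV w : cmod w^-1 = (cmod w)^-1.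
Proof. exact: ComplexField.Normc.normcV. Qed.

Lemma cmodD w z : cmod (w + z) <= cmod w + cmod z.
Proof. exact: le_normcD. Qed.

Lemma cmodN w : cmod (- w) = cmod w.
Proof. exact: normcN. Qed.

Lemma cmodB w z : cmod (w - z) = cmod (z - w).
Proof. by rewrite -cmodN opprB. Qed.

Lemma cmod0 : cmod (0 : Cplx R) = 0.
Proof. exact: ComplexField.Normc.normc0. Qed.

Lemma cmod1 : cmod (1 : Cplx R) = 1.
Proof. exact: ComplexField.Normc.normc1. Qed.

Lemma cmod_eq0 w : cmod w = 0 -> w = 0.
Proof. exact: ComplexField.Normc.eq0_normc. Qed.

Lemma cmod_gt0 w : w != 0 -> 0 < cmod w.
Proof.
move=> w0; rewrite lt_neqAle cmod_ge0 andbT; apply: contra w0 => /eqP.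
by move=> /esym/cmod_eq0 ->.
Qed.

Lemma cmod_real r : cmod (Complex r 0) = `|r|.
Proof. by rewrite /cmod /= expr0n /= addr0 sqrtr_sqr. Qed.

Lemma cmod_imag r : cmod (Complex 0 r) = `|r|.
Proof. by rewrite /cmod /= expr0n /= add0r sqrtr_sqr. Qed.

Lemma Re_le_cmod w : `|complex.Re w| <= cmod w.
Proof.
case: w => a b; rewrite /cmod /= -sqrtr_sqr ler_wsqrtr //.
by rewrite lerDl sqr_ge0.
Qed.

Lemma Im_le_cmod w : `|complex.Im w| <= cmod w.
Proof.
case: w => a b; rewrite /cmod /= -sqrtr_sqr ler_wsqrtr //.
by rewrite lerDr sqr_ge0.
Qed.

Lemma cmod_le_ReIm w : cmod w <= `|complex.Re w| + `|complex.Im w|.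
Proof.
case: w => a b; rewrite -(cmod_real a) -(cmod_imag b).
apply: le_trans (cmodD _ _).
by rewrite (_ : Complex a 0 + Complex 0 b = Complex a b) //;
  congr Complex; rewrite ?addr0 ?add0r.
Qed.

Lemma ReD w z : complex.Re (w + z) = complex.Re w + complex.Re z.
Proof. by case: w; case: z. Qed.
Lemma ImD w z : complex.Im (w + z) = complex.Im w + complex.Im z.
Proof. by case: w; case: z. Qed.
Lemma ReN w : complex.Re (- w) = - complex.Re w.
Proof. by case: w. Qed.
Lemma ImN w : complex.Im (- w) = - complex.Im w.
Proof. by case: w. Qed.

Lemma lt_normC w r : (`|w| < Complex r 0) = (cmod w < r).
Proof. by rewrite normE ltcR. Qed.

Lemma nbhs_cmodP w (A : set (Cplx R)) :
  nbhs w A <-> exists2 r : R, 0 < r & forall z, cmod (z - w) < r -> A z.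
Proof.
split=> [/nbhs_ballP[e /= e0 eA]|[r r0 rA]].
  (* Ball radii also live in [Cplx R]; positivity there forces the imaginary part to vanish. *)
  have eE : e = Complex (complex.Re e) 0.
    by move: e0; rewrite ltcE => /andP[/eqP + _]; case: (e) => a b /= ->.
  exists (complex.Re e) => [|z zw].
    by move: e0; rewrite ltcE => /andP[].
  by apply: eA; rewrite /ball /= distrC eE lt_normC.
apply/nbhs_ballP; exists (Complex r 0) => /=; first by rewrite ltcR.
by move=> z; rewrite /ball /= distrC lt_normC => /rA.
Qed.

Lemma continuous_cmodP f w : {for w, continuous f} <->
  forall e, 0 < e -> exists2 r, 0 < r &
    forall z, cmod (z - w) < r -> cmod (f z - f w) < e.
Proof.
split=> [fw e e0|fw A /nbhs_cmodP[e e0 eA]].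
  have : nbhs (f w) [set y | cmod (y - f w) < e].
    by apply/nbhs_cmodP; exists e.
  by move=> /fw /nbhs_cmodP.
have [r r0 rf] := fw _ e0.
by apply/nbhs_cmodP; exists r => // z zr; apply: eA; exact: rf.
Qed.

(** The division-free form covers [z = w] as well, both sides being 0, so later estimates carry no
    side condition. *)
Lemma is_derive_cmodP f w d : is_derive w 1 f d <->
  forall e, 0 < e -> exists2 r, 0 < r & forall z, cmod (z - w) < r ->
    cmod (f z - f w - d * (z - w)) <= e * cmod (z - w).
Proof.
have quot (h : Cplx R) : h != 0 ->
    cmod (f (h + w) - f w - d * h) =
    cmod (h^-1 *: ((f \o shift w) (h *: (1 : Cplx R)) - f w) - d) * cmod h.
  move=> h0; rewrite -cmodM; congr cmod.
  rewrite mulrBl /= /GRing.scale /= mulr1 [h^-1 * _]mulrC -mulrA mulVf //.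
  by rewrite mulr1.
split=> [[dvf dE] e e0|H].
  have : (fun h => h^-1 *: ((f \o shift w) (h *: (1 : Cplx R)) - f w)) @ 0^' --> d.
    by rewrite -dE.
  have nd : nbhs d [set y | cmod (y - d) < e] by apply/nbhs_cmodP; exists e.
  move=> /(_ _ nd); rewrite /nbhs /= /dnbhs /within /= => /nbhs_cmodP[r r0 rP].
  exists r => // z zr; have [zw|zw] := eqVneq (z - w) 0.
    by move/eqP: zw; rewrite subr_eq0 => /eqP ->; rewrite !subrr mulr0 subr0
      cmod0 mulr0.
  have := rP (z - w); rewrite subr0 => /(_ zr zw) /= lte.
  have := quot _ zw; rewrite subrK => ->.
  by rewrite ler_wpM2r ?cmod_ge0 // ltW.
suff cv : (fun h => h^-1 *: ((f \o shift w) (h *: (1 : Cplx R)) - f w)) @ 0^' --> d.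
  split; first by apply/cvg_ex; exists d.
  by apply: cvg_lim => //; exact: norm_hausdorff.
move=> A /nbhs_cmodP[e e0 eA].
(* Halving [e] turns the non-strict bound in [H] into the strict one that a ball requires. *)
have e20 : 0 < e / 2 by rewrite divr_gt0.
have [r r0 rP] := H _ e20.
rewrite /nbhs /= /dnbhs /within /=; apply/nbhs_cmodP; exists r => // h.
rewrite subr0 => hr h0; apply: eA.
have hgt := cmod_gt0 h0.
have := rP (h + w); rewrite addrK => /(_ hr).
rewrite quot // ler_pM2r // => /le_lt_trans; apply.
by rewrite ltr_pdivrMr // ltr_pMr // ltr1n.
Qed.

Lemma continuous_cst k w : {for w, continuous (fun=> k : Cplx R)}.
Proof. exact: cst_continuous. Qed.

Lemma continuous_add f g w : {for w, continuous f} -> {for w, continuous g} ->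
  {for w, continuous (fun z => f z + g z)}.
Proof. exact: (@continuousD (Cplx R) (Cplx R) (Cplx R) f g w). Qed.

Lemma continuous_sub f g w : {for w, continuous f} -> {for w, continuous g} ->
  {for w, continuous (fun z => f z - g z)}.
Proof. exact: (@continuousB (Cplx R) (Cplx R) (Cplx R) f g w). Qed.

Lemma continuous_mul f g w : {for w, continuous f} -> {for w, continuous g} ->
  {for w, continuous (fun z => f z * g z)}.
Proof. exact: (@continuousM (Cplx R) (Cplx R) f g w). Qed.

Lemma continuous_inv f w : f w != 0 -> {for w, continuous f} ->
  {for w, continuous (fun z => (f z)^-1)}.
Proof. exact: (@continuousV (Cplx R) (Cplx R) f w). Qed.

Lemma continuous_subr k w : {for w, continuous (fun z : Cplx R => z - k)}.
Proof. by apply: continuous_sub; [exact: cvg_id|exact: continuous_cst]. Qed.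

Lemma is_derive_continuous f w d : is_derive w 1 f d -> {for w, continuous f}.
Proof. by move=> [df _]; apply/differentiable_continuous/derivable1_diffP. Qed.

End ComplexNorm.

(** * Integrals of continuous real functions over a segment *)

Section RealIntegral.
Context {R : realType}.
Implicit Types (a b m M : R) (f g : R -> R).
Local Notation mu := (@lebesgue_measure R).

(** Continuity is two-sided even at the end points: the integrands are restrictions of functions
    continuous at each point of the contour as functions on the plane. *)
Definition seg_continuous (T : topologicalType) a b (f : R -> T) :=
  forall x, a <= x <= b -> {for x, continuous f}.

Definition rintegral a b f : R := \int[mu]_(x in `[a, b]) f x.

Lemma seg_continuous_within (T : topologicalType) a b (f : R -> T) :
  seg_continuous a b f -> {within `[a, b], continuous f}.
Proof.
by move=> cf; apply: continuous_in_subspaceT => x /set_mem /=; rewrite in_itv;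
  exact: cf.
Qed.

Lemma rintegral_integrable a b f :
  seg_continuous a b f -> mu.-integrable `[a, b] (EFin \o f).
Proof.
move=> cf; apply: continuous_compact_integrable; first exact: segment_compact.
exact: seg_continuous_within.
Qed.

Lemma rintegral_add a b f g : seg_continuous a b f -> seg_continuous a b g ->
  rintegral a b (fun x => f x + g x) = rintegral a b f + rintegral a b g.
Proof. by move=> /rintegral_integrable fi /rintegral_integrable gi; rewrite /rintegral RintegralD. Qed.

Lemma rintegral_scale a b k f : seg_continuous a b f ->
  rintegral a b (fun x => k * f x) = k * rintegral a b f.
Proof. by move=> /rintegral_integrable fi; rewrite /rintegral RintegralZl. Qed.

Lemma rintegral_split a m b f : a <= m -> m <= b -> seg_continuous a b f ->
  rintegral a b f = rintegral a m f + rintegral m b f.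
Proof.
move=> am mb /[dup] cf /rintegral_integrable fi; rewrite /rintegral.
(* The two segments share [m], so the second is first replaced by the half-open interval, which
   differs by a null set. *)
rewrite -[\int[mu]_(x in `[m, b]) f x]Rintegral_itv_obnd_cbnd; last first.
  apply: integrableS fi => //.
  by apply: subset_itv; rewrite bnd_simp.
have := @Rintegral_itvB _ f (BLeft a) (BRight b) m fi.
by rewrite !bnd_simp am mb => /(_ isT isT) <-; rewrite addrC subrK.
Qed.

Lemma rintegral_cst a b k : a <= b -> rintegral a b (fun=> k) = k * (b - a).
Proof.
move=> ab; rewrite /rintegral Rintegral_cst //= lebesgue_measure_itv /=.
rewrite lte_fin; case: ltP => //= ba.
have -> : a = b by apply/eqP; rewrite eq_le ab ba.
by rewrite subrr.
Qed.

Lemma rintegral_le a b f g : seg_continuous a b f -> seg_continuous a b g ->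
  (forall x, a <= x <= b -> f x <= g x) -> rintegral a b f <= rintegral a b g.
Proof.
move=> /rintegral_integrable fi /rintegral_integrable gi fg; exact: le_Rintegral.
Qed.

Lemma rintegral_abs a b f M : a <= b -> seg_continuous a b f ->
  (forall x, a <= x <= b -> `|f x| <= M) -> `|rintegral a b f| <= M * (b - a).
Proof.
move=> ab cf fM; rewrite ler_norml; apply/andP; split.
  rewrite -mulNr -rintegral_cst //; apply: rintegral_le => //.
    by move=> x _; exact: cst_continuous.
  by move=> x /fM; rewrite ler_norml => /andP[].
rewrite -rintegral_cst //; apply: rintegral_le => //; first by move=> x _; exact: cst_continuous.
by move=> x /fM; rewrite ler_norml => /andP[].
Qed.

Lemma rintegral_FTC a b f F : a <= b -> seg_continuous a b f ->
  (forall x, a <= x <= b -> is_derive x 1 F (f x)) -> rintegral a b f = F b - F a.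
Proof.
rewrite le_eqVlt => /predU1P[-> cf _|ab cf dF].
  by rewrite /rintegral set_itv1 Rintegral_set1 subrr.
have contF x : a <= x <= b -> {for x, continuous F}.
  by move=> /dF[dFx _]; apply/differentiable_continuous/derivable1_diffP.
rewrite /rintegral /Rintegral (@continuous_FTC2 _ f F) //.
- exact: seg_continuous_within.
- split.
  + by move=> x; rewrite in_itv => /andP[/ltW ax /ltW xb];
      have [] := dF x; rewrite ?ax.
  + by apply: cvg_at_right_filter; apply: contF; rewrite lexx ltW.
  + by apply: cvg_at_left_filter; apply: contF; rewrite lexx ltW.
- move=> x; rewrite in_itv => /andP[/ltW ax /ltW xb].
  by rewrite derive1E; have [] := dF x; rewrite ?ax.
Qed.

Lemma eq_rintegral a b f g : (forall x, a <= x <= b -> f x = g x) -> rintegral a b f = rintegral a b g.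
Proof.
by move=> fg; apply: eq_Rintegral => x /set_mem /=; rewrite in_itv; exact: fg.
Qed.

End RealIntegral.

(** * Complex-valued integrals over a real segment *)

Section ComplexIntegral.
Context {R : realType}.
Implicit Types (a b m M : R) (p q : R -> Cplx R) (k : Cplx R).

Definition cintegral a b p : Cplx R :=
  Complex (rintegral a b (fun t => complex.Re (p t))) (rintegral a b (fun t => complex.Im (p t))).

Lemma continuous_Re : continuous (@complex.Re R : Cplx R -> R).
Proof.
move=> w A /nbhs_ballP[e /= e0 eA]; apply/nbhs_cmodP; exists e => // z zw.
apply: eA; rewrite /ball /= -ReN -ReD; apply: le_lt_trans (Re_le_cmod _) _.
by rewrite cmodB.
Qed.

Lemma continuous_Im : continuous (@complex.Im R : Cplx R -> R).
Proof.
move=> w A /nbhs_ballP[e /= e0 eA]; apply/nbhs_cmodP; exists e => // z zw.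
apply: eA; rewrite /ball /= -ImN -ImD; apply: le_lt_trans (Im_le_cmod _) _.
by rewrite cmodB.
Qed.

Lemma seg_continuous_Re a b p :
  seg_continuous a b p -> seg_continuous a b (fun t => complex.Re (p t)).
Proof.
move=> cp x xab; apply: (@continuous_comp _ _ _ p (@complex.Re R : Cplx R -> R)).
  exact: cp.
exact: continuous_Re.
Qed.

Lemma seg_continuous_Im a b p :
  seg_continuous a b p -> seg_continuous a b (fun t => complex.Im (p t)).
Proof.
move=> cp x xab; apply: (@continuous_comp _ _ _ p (@complex.Im R : Cplx R -> R)).
  exact: cp.
exact: continuous_Im.
Qed.

Lemma eq_cintegral a b p q : (forall t, a <= t <= b -> p t = q t) -> cintegral a b p = cintegral a b q.
Proof. by move=> pq; congr Complex; apply: eq_rintegral => t /pq ->. Qed.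

Lemma cintegral_add a b p q : seg_continuous a b p -> seg_continuous a b q ->
  cintegral a b (fun t => p t + q t) = cintegral a b p + cintegral a b q.
Proof.
move=> cp cq; rewrite /cintegral; congr Complex; rewrite -rintegral_add;
  do ?[exact: seg_continuous_Re | exact: seg_continuous_Im].
  by apply: eq_rintegral => t _; exact: ReD.
by apply: eq_rintegral => t _; exact: ImD.
Qed.

Lemma cintegral_scale a b k p : seg_continuous a b p ->
  cintegral a b (fun t => k * p t) = k * cintegral a b p.
Proof.
move=> cp; have cR := seg_continuous_Re cp; have cI := seg_continuous_Im cp.
have cZ c (f : R -> R) : seg_continuous a b f -> seg_continuous a b (fun t => c * f t).
  by move=> cf x xab; apply: continuousM; [exact: cst_continuous|exact: cf].
case: k => u v; congr Complex.
  rewrite -mulNr -!rintegral_scale // -rintegral_add; do ?exact: cZ.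
  by apply: eq_rintegral => t _; case: (p t) => x y /=; rewrite mulNr.
rewrite -!rintegral_scale // -rintegral_add; do ?exact: cZ.
by apply: eq_rintegral => t _; case: (p t).
Qed.

Lemma cintegral_split a m b p : a <= m -> m <= b -> seg_continuous a b p ->
  cintegral a b p = cintegral a m p + cintegral m b p.
Proof.
move=> am mb cp; congr Complex; apply: rintegral_split => //.
  exact: seg_continuous_Re.
exact: seg_continuous_Im.
Qed.

(** The factor 2 is the price of bounding the real and imaginary parts separately. *)
Lemma cmod_cintegral a b p M : a <= b -> seg_continuous a b p ->
  (forall t, a <= t <= b -> cmod (p t) <= M) -> cmod (cintegral a b p) <= 2 * M * (b - a).
Proof.
move=> ab cp pM; apply: le_trans (cmod_le_ReIm _) _; rewrite /= mulr2n !mulrDl !mul1r.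
apply: lerD; apply: rintegral_abs => //.
- exact: seg_continuous_Re.
- by move=> t /pM; apply: le_trans; exact: Re_le_cmod.
- exact: seg_continuous_Im.
- by move=> t /pM; apply: le_trans; exact: Im_le_cmod.
Qed.

Lemma cintegral_FTC a b p (P : R -> Cplx R) : a <= b -> seg_continuous a b p ->
  (forall t, a <= t <= b -> is_derive t 1 (fun s => complex.Re (P s)) (complex.Re (p t))) ->
  (forall t, a <= t <= b -> is_derive t 1 (fun s => complex.Im (P s)) (complex.Im (p t))) ->
  cintegral a b p = P b - P a.
Proof.
move=> ab cp dR dI; rewrite /cintegral (rintegral_FTC ab _ dR) ?(rintegral_FTC ab _ dI).
- by case: (P a); case: (P b).
- exact: seg_continuous_Im.
- exact: seg_continuous_Re.
Qed.

End ComplexIntegral.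

(** * Contour integrals along the boundary of a rectangle *)

Section RectangleIntegral.
Context {R : realType}.
Implicit Types (a b c d x y M : R) (f g : Cplx R -> Cplx R) (k w z : Cplx R).
Local Notation ci := (Complex 0 1 : Cplx R).

Definition frame a b c d w :=
  [/\ a <= complex.Re w <= b, c <= complex.Im w <= d &
   [\/ complex.Re w = a, complex.Re w = b, complex.Im w = c | complex.Im w = d]].

Definition rect a b c d w := a <= complex.Re w <= b /\ c <= complex.Im w <= d.

Definition continuous_on (A : Cplx R -> Prop) f :=
  forall w, A w -> {for w, continuous f}.

(** The boundary is run counterclockwise: the minus signs reverse the top and left edges, and [ci]
    is dz/dt on the vertical ones. *)
Definition rect_integral a b c d f : Cplx R :=
  cintegral a b (fun t => f (Complex t c)) + ci * cintegral c d (fun t => f (Complex b t))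
  - cintegral a b (fun t => f (Complex t d)) - ci * cintegral c d (fun t => f (Complex a t)).

Lemma frame_rect a b c d w : frame a b c d w -> rect a b c d w.
Proof. by case. Qed.

Lemma rect_continuous a b c d f :
  continuous_on (rect a b c d) f -> continuous_on (frame a b c d) f.
Proof. by move=> cf w /frame_rect /cf. Qed.

Lemma continuous_horizontal y : continuous (fun t : R => (Complex t y : Cplx R)).
Proof.
move=> t A /nbhs_cmodP[e e0 eA]; apply/nbhs_ballP; exists e => //= s.
rewrite /ball /= distrC => st; apply: eA.
by rewrite (_ : _ - _ = Complex (s - t) 0) ?cmod_real //; congr Complex; exact: subrr.
Qed.

Lemma continuous_vertical x : continuous (fun t : R => (Complex x t : Cplx R)).
Proof.
move=> t A /nbhs_cmodP[e e0 eA]; apply/nbhs_ballP; exists e => //= s.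
rewrite /ball /= distrC => st; apply: eA.
by rewrite (_ : _ - _ = Complex 0 (s - t)) ?cmod_imag //; congr Complex; exact: subrr.
Qed.

Lemma seg_horizontal a b y f :
  (forall t, a <= t <= b -> {for Complex t y, continuous f}) ->
  seg_continuous a b (fun t => f (Complex t y)).
Proof.
move=> cf t tab; apply: (@continuous_comp _ _ _ (fun t => Complex t y : Cplx R) f).
  exact: continuous_horizontal.
exact: cf.
Qed.

Lemma seg_vertical a b x f :
  (forall t, a <= t <= b -> {for Complex x t, continuous f}) ->
  seg_continuous a b (fun t => f (Complex x t)).
Proof.
move=> cf t tab; apply: (@continuous_comp _ _ _ (fun t => Complex x t : Cplx R) f).
  exact: continuous_vertical.
exact: cf.
Qed.

Section Edges.
Variables (a b c d : R).
Hypotheses (ab : a <= b) (cd : c <= d).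

Lemma frame_bottom t : a <= t <= b -> frame a b c d (Complex t c).
Proof. by move=> tab; split => //=; rewrite ?lexx ?cd //; exact: Or43. Qed.
Lemma frame_top t : a <= t <= b -> frame a b c d (Complex t d).
Proof. by move=> tab; split => //=; rewrite ?lexx ?cd //; exact: Or44. Qed.
Lemma frame_left t : c <= t <= d -> frame a b c d (Complex a t).
Proof. by move=> tcd; split => //=; rewrite ?lexx ?ab //; exact: Or41. Qed.
Lemma frame_right t : c <= t <= d -> frame a b c d (Complex b t).
Proof. by move=> tcd; split => //=; rewrite ?lexx ?ab //; exact: Or42. Qed.

Lemma edges_continuous f : continuous_on (frame a b c d) f ->
  [/\ seg_continuous a b (fun t => f (Complex t c)),
      seg_continuous c d (fun t => f (Complex b t)),
      seg_continuous a b (fun t => f (Complex t d)) &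
      seg_continuous c d (fun t => f (Complex a t))].
Proof.
move=> cf; split.
- by apply: seg_horizontal => t /frame_bottom/cf.
- by apply: seg_vertical => t /frame_right/cf.
- by apply: seg_horizontal => t /frame_top/cf.
- by apply: seg_vertical => t /frame_left/cf.
Qed.

Lemma eq_rect_integral f g : (forall w, frame a b c d w -> f w = g w) ->
  rect_integral a b c d f = rect_integral a b c d g.
Proof.
move=> fg; rewrite /rect_integral; congr (_ + _ * _ - _ - _ * _); apply: eq_cintegral => t.
- by move=> /frame_bottom/fg.
- by move=> /frame_right/fg.
- by move=> /frame_top/fg.
- by move=> /frame_left/fg.
Qed.

Lemma rect_integral_add f g : continuous_on (frame a b c d) f ->
  continuous_on (frame a b c d) g ->
  rect_integral a b c d (fun w => f w + g w) = rect_integral a b c d f + rect_integral a b c d g.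
Proof.
move=> /edges_continuous[f1 f2 f3 f4] /edges_continuous[g1 g2 g3 g4].
by rewrite /rect_integral !cintegral_add //; ring.
Qed.

Lemma rect_integral_scale k f : continuous_on (frame a b c d) f ->
  rect_integral a b c d (fun w => k * f w) = k * rect_integral a b c d f.
Proof. by move=> /edges_continuous[f1 f2 f3 f4]; rewrite /rect_integral !cintegral_scale //; ring. Qed.

Lemma cmod_ci : cmod ci = 1.
Proof. by rewrite cmod_imag normr1. Qed.

(** The perimeter times [M], doubled by the loss in [cmod_cintegral]. *)
Lemma cmod_rect_integral f M : continuous_on (frame a b c d) f ->
  (forall w, frame a b c d w -> cmod (f w) <= M) ->
  cmod (rect_integral a b c d f) <= 4 * M * ((b - a) + (d - c)).
Proof.
move=> /edges_continuous[f1 f2 f3 f4] fM; rewrite /rect_integral.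
have h1 := cmod_cintegral ab f1 (fun t h => fM _ (frame_bottom h)).
have h2 := cmod_cintegral cd f2 (fun t h => fM _ (frame_right h)).
have h3 := cmod_cintegral ab f3 (fun t h => fM _ (frame_top h)).
have h4 := cmod_cintegral cd f4 (fun t h => fM _ (frame_left h)).
apply: le_trans (cmodD _ _) _; rewrite cmodN cmodM cmod_ci mul1r.
have := cmodD (cintegral a b (fun t => f (Complex t c)) + ci * cintegral c d (fun t => f (Complex b t)))
  (- cintegral a b (fun t => f (Complex t d))).
have := cmodD (cintegral a b (fun t => f (Complex t c))) (ci * cintegral c d (fun t => f (Complex b t))).
rewrite cmodN cmodM cmod_ci mul1r; lra.
Qed.

End Edges.

Lemma rect_integral_split_x a m b c d f : a <= m <= b -> c <= d ->
  continuous_on (rect a b c d) f ->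
  rect_integral a b c d f = rect_integral a m c d f + rect_integral m b c d f.
Proof.
move=> /andP[am mb] cd /rect_continuous cf.
have [f1 f2 f3 f4] := edges_continuous (le_trans am mb) cd cf.
by rewrite /rect_integral (cintegral_split am mb f1) (cintegral_split am mb f3); ring.
Qed.

Lemma rect_integral_split_y a b c m d f : a <= b -> c <= m <= d ->
  continuous_on (rect a b c d) f ->
  rect_integral a b c d f = rect_integral a b c m f + rect_integral a b m d f.
Proof.
move=> ab /andP[cm md] /rect_continuous cf.
have [f1 f2 f3 f4] := edges_continuous ab (le_trans cm md) cf.
by rewrite /rect_integral (cintegral_split cm md f2) (cintegral_split cm md f4); ring.
Qed.

Lemma is_derive_real (F : R -> R) (t l : R) :
  (forall e, 0 < e -> exists2 r, 0 < r & forall s, `|s - t| < r ->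
    `|F s - F t - l * (s - t)| <= e * `|s - t|) -> is_derive t 1 F l.
Proof.
move=> H.
suff cv : (fun h => h^-1 *: ((F \o shift t) (h *: (1 : R)) - F t)) @ 0^' --> l.
  by split; [apply/cvg_ex; exists l|exact: cvg_lim].
apply/cvgrPdist_le => e e0.
have [r r0 rP] := H _ e0.
rewrite /dnbhs /=; near=> h.
have h0 : h != 0 by near: h; exact: nbhs_dnbhs_neq.
have hr : `|h| < r by near: h; exact: dnbhs0_lt.
have := rP (h + t); rewrite addrK => /(_ hr).
rewrite -ler_pdivrMr ?normr_gt0 // -normf_div distrC; congr (`|_| <= _).
by rewrite /= /GRing.scale /= mulr1; field.
Unshelve. all: by end_near. Qed.

(** This chain rule mixes two fields, [P] being differentiated over the complex numbers and its
    components along the line over the reals. It is read off from the first-order estimate, whose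
    real and imaginary parts are the two conclusions. *)
Lemma is_derive_path (P : Cplx R -> Cplx R) (z v l : Cplx R) (t : R) :
  is_derive (z + Complex t 0 * v) 1 P l ->
  is_derive t 1 (fun s => complex.Re (P (z + Complex s 0 * v))) (complex.Re (l * v)) /\
  is_derive t 1 (fun s => complex.Im (P (z + Complex s 0 * v))) (complex.Im (l * v)).
Proof.
move=> /is_derive_cmodP H.
suff K e : 0 < e -> exists2 r : R, 0 < r & forall s, `|s - t| < r ->
  cmod (P (z + Complex s 0 * v) - P (z + Complex t 0 * v) - Complex (s - t) 0 * (l * v))
    <= e * `|s - t|.
  have ReM (s : R) (w : Cplx R) : complex.Re (Complex s 0 * w) = complex.Re w * s.
    by case: w => u w /=; rewrite mul0r subr0 mulrC.
  have ImM (s : R) (w : Cplx R) : complex.Im (Complex s 0 * w) = complex.Im w * s.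
    by case: w => u w /=; rewrite mul0r addr0 mulrC.
  split; apply: is_derive_real => e /K[r r0 rP]; exists r => // s /rP.
    by apply: le_trans; apply: le_trans (Re_le_cmod _); rewrite !ReD !ReN ReM.
  by apply: le_trans; apply: le_trans (Im_le_cmod _); rewrite !ImD !ImN ImM.
move=> e0.
(* The added 1 keeps the denominator positive when [v = 0]; the same device recurs below. *)
have v1 : 0 < cmod v + 1 by rewrite ltr_wpDl ?cmod_ge0.
have [r r0 rP] := H _ (divr_gt0 e0 v1).
exists (r / (cmod v + 1)) => [|s st]; first exact: divr_gt0.
have E : z + Complex s 0 * v - (z + Complex t 0 * v) = Complex (s - t) 0 * v.
  rewrite opprD addrACA subrr add0r -mulrBl; congr (_ * _).
  by congr Complex; exact: subrr.
have vle : cmod v <= cmod v + 1 by rewrite lerDl.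
have := rP (z + Complex s 0 * v); rewrite E cmodM cmod_real => h.
rewrite mulrCA; apply: le_trans (h _) _.
  apply: le_lt_trans (_ : `|s - t| * (cmod v + 1) < r); first by rewrite ler_wpM2l.
  by rewrite -ltr_pdivlMr.
have -> : e / (cmod v + 1) * (`|s - t| * cmod v)
    = e * `|s - t| * (cmod v / (cmod v + 1)) by ring.
rewrite ler_piMr ?mulr_ge0 ?(ltW e0) //.
by rewrite ler_pdivrMr // mul1r.
Qed.

(** Each edge contributes a difference of values of [P] at two corners, and around the closed
    contour these cancel. *)
Lemma rect_integral_primitive a b c d f (P : Cplx R -> Cplx R) : a <= b -> c <= d ->
  continuous_on (frame a b c d) f ->
  (forall w, frame a b c d w -> is_derive w 1 P (f w)) -> rect_integral a b c d f = 0.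
Proof.
move=> ab cd cf dP; have [f1 f2 f3 f4] := edges_continuous ab cd cf.
have hor y : (forall t, a <= t <= b -> frame a b c d (Complex t y)) ->
    seg_continuous a b (fun t => f (Complex t y)) ->
    cintegral a b (fun t => f (Complex t y)) = P (Complex b y) - P (Complex a y).
  move=> fr fy; have E t : Complex t y = Complex 0 y + Complex t 0 * 1 :> Cplx R.
    by rewrite mulr1; congr Complex; rewrite ?add0r ?addr0.
  apply: (@cintegral_FTC _ _ _ _ (fun t => P (Complex t y)) ab fy) => t /fr/dP.
    rewrite {1}E => /is_derive_path[+ _]; rewrite mulr1.
    by under eq_fun do rewrite -E.
  rewrite {1}E => /is_derive_path[_ +]; rewrite mulr1.
  by under eq_fun do rewrite -E.
have ver x : (forall t, c <= t <= d -> frame a b c d (Complex x t)) ->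
    seg_continuous c d (fun t => f (Complex x t)) ->
    ci * cintegral c d (fun t => f (Complex x t)) = P (Complex x d) - P (Complex x c).
  move=> fr fx; have E t : Complex x t = Complex x 0 + Complex t 0 * ci :> Cplx R.
    by congr Complex; rewrite /=; ring.
  rewrite -cintegral_scale //.
  apply: (@cintegral_FTC _ _ _ _ (fun t => P (Complex x t)) cd).
  - by move=> t tcd; apply: continuousM; [exact: cst_continuous|exact: fx].
  - move=> t /fr/dP; rewrite {1}E => /is_derive_path[+ _]; rewrite mulrC.
    by under eq_fun do rewrite -E.
  - move=> t /fr/dP; rewrite {1}E => /is_derive_path[_ +]; rewrite mulrC.
    by under eq_fun do rewrite -E.
rewrite /rect_integral (hor _ (frame_bottom cd) f1) (hor _ (frame_top cd) f3).
rewrite (ver _ (frame_right ab) f2) (ver _ (frame_left ab) f4).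
by ring.
Qed.

End RectangleIntegral.

(** * Goursat's theorem, also with an exceptional point *)

Section Goursat.
Context {R : realType}.
Implicit Types (a b c d x y M w h : R) (f : Cplx R -> Cplx R).

Lemma nested_intervals (u v : nat -> R) : (forall n, u n <= u n.+1) ->
  (forall n, v n.+1 <= v n) -> (forall n, u n <= v n) ->
  exists x, forall n, u n <= x <= v n.
Proof.
move=> ui vd uv.
have um : {homo u : m n / (m <= n)%N >-> m <= n} by apply: homo_leq => //; exact: le_trans.
have vm : {homo v : m n / (m <= n)%N >-> n <= m}.
  by apply: homo_leq => // x y z xy yz; exact: le_trans yz xy.
have uvmn m n : u m <= v n.
  apply: le_trans (um _ _ (leq_maxl m n)) _.
  by apply: le_trans (uv _) _; exact: vm (leq_maxr m n).
exists (sup (range u)) => n; apply/andP; split.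
  by apply: ub_le_sup; [exists (v 0) => _ [m _ <-]|exists n].
by apply: ge_sup; [exists (u 0); exists 0|move=> _ [m _ <-]].
Qed.

(* Lower left corners are the only data of the rectangles of level n, whose
   sides are w / 2 ^+ n and h / 2 ^+ n. *)
Lemma quadrisection (P : nat -> R -> R -> Prop) w h x0 y0 : 0 <= w -> 0 <= h ->
  (forall n x y, P n.+1 x y -> P n.+1 (x + w / 2 ^+ n.+1) y ->
     P n.+1 x (y + h / 2 ^+ n.+1) ->
     P n.+1 (x + w / 2 ^+ n.+1) (y + h / 2 ^+ n.+1) -> P n x y) ->
  (forall x y, exists2 r, 0 < r & forall n x' y',
     x' <= x <= x' + w / 2 ^+ n -> y' <= y <= y' + h / 2 ^+ n ->
     w / 2 ^+ n < r -> h / 2 ^+ n < r -> P n x' y') ->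
  P 0 x0 y0.
Proof.
(* If [P] failed at the start, it would fail on some quarter at every level. The chosen quarters
   shrink to a point, near which [localP] makes [P] true. *)
move=> w0 h0 split4 localP; apply: contrapT => nP.
pose Q n (p q : R * R) := [/\ ~ P n.+1 q.1 q.2,
  p.1 <= q.1 <= p.1 + w / 2 ^+ n.+1 & p.2 <= q.2 <= p.2 + h / 2 ^+ n.+1].
have halfw n : 0 <= w / 2 ^+ n by rewrite divr_ge0 // exprn_ge0.
have halfh n : 0 <= h / 2 ^+ n by rewrite divr_ge0 // exprn_ge0.
have step n p : ~ P n p.1 p.2 -> exists q, Q n p q.
  move=> nPn; apply: contrapT => /forallNP nQ; apply: nPn.
  apply: split4; apply: contrapT => nP4.
  - by apply: (nQ p); split=> //; rewrite lexx /= lerDl ?halfw ?halfh.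
  - by apply: (nQ (p.1 + w / 2 ^+ n.+1, p.2)); split=> //=; rewrite lexx /= lerDl ?halfw ?halfh.
  - by apply: (nQ (p.1, p.2 + h / 2 ^+ n.+1)); split=> //=; rewrite lexx /= lerDl ?halfw ?halfh.
  - by apply: (nQ (p.1 + w / 2 ^+ n.+1, p.2 + h / 2 ^+ n.+1)); split=> //=;
      rewrite lexx /= lerDl ?halfw ?halfh.
(* The default [s m] of [xget] is never taken, since [step] provides a failing quarter. *)
pose s := fix s n := if n is m.+1 then xget (s m) [set q | Q m (s m) q] else (x0, y0).
have sP n : ~ P n (s n).1 (s n).2 /\ Q n (s n) (s n.+1).
  elim: n => [|n [_ IH]].
    by split=> //; exact: (xgetPex _ (step 0%N (x0, y0) nP)).
  have nPn : ~ P n.+1 (s n.+1).1 (s n.+1).2 by case: IH.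
  by split=> //; exact: (xgetPex _ (step _ _ nPn)).
have halve (l : R) n : l / 2 ^+ n = l / 2 ^+ n.+1 + l / 2 ^+ n.+1.
  by rewrite exprS; field; rewrite expf_neq0.
have [x xP] : exists x, forall n, (s n).1 <= x <= (s n).1 + w / 2 ^+ n.
  apply: nested_intervals => n; last by rewrite lerDl.
    by have [_ [_ /andP[]]] := sP n.
  by have [_ [_ /andP[_ sx] _]] := sP n; rewrite (halve w n) addrA lerD2r.
have [y yP] : exists y, forall n, (s n).2 <= y <= (s n).2 + h / 2 ^+ n.
  apply: nested_intervals => n; last by rewrite lerDl.
    by have [_ [_ _ /andP[]]] := sP n.
  by have [_ [_ _ /andP[_ sy]]] := sP n; rewrite (halve h n) addrA lerD2r.
have [r r0 rP] := localP x y.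
have [n nr] : exists n, (w + h) / 2 ^+ n < r.
  have wh0 : 0 <= (w + h) / r by rewrite divr_ge0 ?addr_ge0 // ltW.
  exists (Num.truncn ((w + h) / r)).+1.
  rewrite ltr_pdivrMr ?exprn_gt0 // mulrC -ltr_pdivrMr //.
  apply: lt_trans (truncnS_gt _) _.
  by rewrite -natrX ltr_nat ltn_expl.
have [nPn _] := sP n; apply: nPn; apply: rP => //; apply: le_lt_trans nr;
  by rewrite mulrDl ?lerDl ?lerDr.
Qed.

Definition affine (p u v : Cplx R) (z : Cplx R) := u + v * (z - p).

Lemma is_derive_affine_primitive p u v (z : Cplx R) :
  is_derive z 1 (fun z => (u + v / 2 * (z - p)) * (z - p)) (affine p u v z).
Proof.
apply/is_derive_cmodP => e e0.
have v1 : 0 < cmod (v / 2) + 1 by rewrite ltr_wpDl ?cmod_ge0.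
exists (e / (cmod (v / 2) + 1)) => [|s sz]; first exact: divr_gt0.
rewrite /affine (_ : _ - _ = v / 2 * (s - z) * (s - z)); last by field.
rewrite !cmodM ler_wpM2r ?cmod_ge0 //.
apply: le_trans (_ : (cmod (v / 2) + 1) * cmod (s - z) <= _).
  by rewrite -cmodM cmodM ler_wpM2r ?cmod_ge0 // lerDl.
by rewrite mulrC -ler_pdivlMr // ltW.
Qed.

Lemma continuous_affine p u v (z : Cplx R) : {for z, continuous (affine p u v)}.
Proof.
rewrite -[affine _ _ _]/(fun y : Cplx R => u + v * (y - p)).
apply: continuous_add; first exact: continuous_cst.
by apply: continuous_mul; [exact: continuous_cst|exact: continuous_subr].
Qed.

(** Near a point, [f] is its affine approximation plus an error small compared with the distance.
    The affine part has a primitive and integrates to 0, and error times perimeter is at most [e]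
    times the square of the size. *)
Lemma goursat a b c d f : a <= b -> c <= d ->
  (forall z, rect a b c d z -> derivable f z 1) -> rect_integral a b c d f = 0.
Proof.
move=> ab cd df.
have cf : continuous_on (rect a b c d) f.
  by move=> z /df dfz; apply/differentiable_continuous/derivable1_diffP.
pose w := b - a; pose h := d - c.
have w0 : 0 <= w by rewrite subr_ge0.
have h0 : 0 <= h by rewrite subr_ge0.
suff small e : 0 < e -> cmod (rect_integral a b c d f) <= e * (w + h) ^+ 2.
  apply: cmod_eq0; apply/eqP; rewrite eq_le cmod_ge0 andbT.
  apply/ler_addgt0Pl => e e0; rewrite addr0.
  have K0 : 0 < (w + h) ^+ 2 + 1 by rewrite ltr_wpDl ?sqr_ge0.
  apply: le_trans (small _ (divr_gt0 e0 K0)) _.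
  by rewrite -mulrA ler_piMr ?(ltW e0) // mulrC ler_pdivrMr // mul1r lerDl.
move=> e0.
(* The bound is quadratic so that four quarters reproduce it: 4 e q^2 = e (2 q)^2. Rectangles that
   leave the given one satisfy [P] vacuously, because [quadrisection] ranges over all corners. *)
pose P n x y := a <= x -> x + w / 2 ^+ n <= b -> c <= y -> y + h / 2 ^+ n <= d ->
  cmod (rect_integral x (x + w / 2 ^+ n) y (y + h / 2 ^+ n) f) <= e * ((w + h) / 2 ^+ n) ^+ 2.
have halve (l : R) n : l / 2 ^+ n = l / 2 ^+ n.+1 + l / 2 ^+ n.+1.
  by rewrite exprS; field; rewrite expf_neq0.
have halfw n : 0 <= w / 2 ^+ n by rewrite divr_ge0 // exprn_ge0.
have halfh n : 0 <= h / 2 ^+ n by rewrite divr_ge0 // exprn_ge0.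
suff : P 0%N a c by rewrite /P expr0 !divr1 !subrKC => -> //.
apply: (@quadrisection P _ _ _ _ w0 h0) => [n x y|x y].
  set x' := x + _; set y' := y + _ => P1 P2 P3 P4.
  move=> ax xb cy yd.
  have Ex : x + w / 2 ^+ n = x' + w / 2 ^+ n.+1 by rewrite (halve w n) addrA.
  have Ey : y + h / 2 ^+ n = y' + h / 2 ^+ n.+1 by rewrite (halve h n) addrA.
  rewrite Ex Ey in xb yd *; set x'' := x' + _ in xb *; set y'' := y' + _ in yd *.
  have x'x'' : x' <= x'' by rewrite lerDl.
  have y'y'' : y' <= y'' by rewrite lerDl.
  have xx' : x <= x' by rewrite lerDl.
  have yy' : y <= y' by rewrite lerDl.
  have x'b : x' <= b := le_trans x'x'' xb.
  have y'd : y' <= d := le_trans y'y'' yd.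
  have cr : continuous_on (rect x (x'') y (y'')) f.
    move=> z [/andP[zx zx'] /andP[zy zy']]; apply: cf; split.
      by rewrite (le_trans ax zx) (le_trans zx' xb).
    by rewrite (le_trans cy zy) (le_trans zy' yd).
  have subr x1 x2 y1 y2 : x <= x1 -> x2 <= x'' -> y <= y1 ->
      y2 <= y'' -> continuous_on (rect x1 x2 y1 y2) f.
    move=> xx1 x2x yy1 y2y z [/andP[zx zx'] /andP[zy zy']]; apply: cr; split.
      by rewrite (le_trans xx1 zx) (le_trans zx' x2x).
    by rewrite (le_trans yy1 zy) (le_trans zy' y2y).
  rewrite (@rect_integral_split_x _ x x') ?xx' ?(le_trans yy') //.
  rewrite (@rect_integral_split_y _ x x' y y') ?yy' //; last exact: subr.
  rewrite (@rect_integral_split_y _ x' _ y y') ?yy' //; last exact: subr.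
  have := P1 ax x'b cy y'd; have := P2 (le_trans ax xx') xb cy y'd.
  have := P3 ax x'b (le_trans cy yy') yd.
  have := P4 (le_trans ax xx') xb (le_trans cy yy') yd.
  rewrite -/x' -/y' (halve (w + h) n).
  set q := (w + h) / 2 ^+ n.+1.
  set J1 := rect_integral x x' y y' f; set J2 := rect_integral x x' y' _ f.
  set J3 := rect_integral x' _ y y' f; set J4 := rect_integral x' _ y' _ f.
  have := cmodD (J1 + J2) (J3 + J4); have := cmodD J1 J2; have := cmodD J3 J4.
  rewrite (_ : e * (q + q) ^+ 2 = 4 * (e * q ^+ 2)); last by ring.
  lra.
(* A limit point outside the given rectangle belongs to no subrectangle of it, so any radius
   serves. *)
have [pin|pout] := pselect (rect a b c d (Complex x y)); last first.
  exists 1 => // n x' y' /andP[x'x xx'] /andP[y'y yy'] _ _ ax' x'b cy' y'd.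
  exfalso; apply: pout; split=> /=.
    by rewrite (le_trans ax') // (le_trans xx').
  by rewrite (le_trans cy') // (le_trans yy').
set p : Cplx R := Complex x y in pin.
have /is_derive_cmodP H := derivableP (df _ pin).
(* The 4 cancels the constant of [cmod_rect_integral]. Below, sides shorter than [r / 2] keep the
   rectangle within distance [r] of [p]. *)
have [|r r0 rP] := H (e / 4); first by rewrite divr_gt0.
exists (r / 2) => [|n x' y' /andP[x'x xx'] /andP[y'y yy'] wr hr ax' x'b cy' y'd].
  by rewrite divr_gt0.
set A := affine p (f p) ('D_1 f p).
rewrite [(w + h) / _]mulrDl; have := halfw n; have := halfh n.
set wn := w / 2 ^+ n; set hn := h / 2 ^+ n => hn0 wn0.
rewrite -/wn -/hn in x'b y'd xx' yy' wr hr.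
have x'w : x' <= x' + wn by rewrite lerDl.
have y'h : y' <= y' + hn by rewrite lerDl.
have cA : continuous_on (frame x' (x' + wn) y' (y' + hn)) A.
  by move=> z _; exact: continuous_affine.
have sub z : frame x' (x' + wn) y' (y' + hn) z -> rect a b c d z.
  move=> [/andP[zx zx'] /andP[zy zy'] _]; split.
    by rewrite (le_trans ax' zx) (le_trans zx' x'b).
  by rewrite (le_trans cy' zy) (le_trans zy' y'd).
have cE : continuous_on (frame x' (x' + wn) y' (y' + hn)) (fun z => f z - A z).
  by move=> z zfr; apply: continuous_sub; [exact/cf/sub|exact: cA].
have -> : rect_integral x' (x' + wn) y' (y' + hn) f =
    rect_integral x' (x' + wn) y' (y' + hn) (fun z => (f z - A z) + A z).
  by apply: eq_rect_integral => // z _; rewrite subrK.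
rewrite rect_integral_add //.
rewrite (rect_integral_primitive x'w y'h cA (fun z _ => is_derive_affine_primitive _ _ _ z)).
rewrite addr0.
have Ebound z : frame x' (x' + wn) y' (y' + hn) z ->
    cmod (f z - A z) <= e / 4 * (wn + hn).
  move=> [/andP[zx zx'] /andP[zy zy'] _].
  have zp : cmod (z - p) <= wn + hn.
    apply: le_trans (cmod_le_ReIm _) _; rewrite ReD ImD ReN ImN /=.
    by apply: lerD; rewrite ler_norml; apply/andP; split; lra.
  have := rP z; rewrite /A /affine opprD addrA => /(_ _)/le_trans; apply.
    by apply: le_lt_trans zp _; lra.
  by rewrite ler_wpM2l // divr_ge0 // ltW.
apply: le_trans (cmod_rect_integral x'w y'h cE Ebound) _.
rewrite (_ : x' + wn - x' = wn) 1?(_ : y' + hn - y' = hn); [|ring|ring].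
by rewrite le_eqVlt; apply/orP; left; apply/eqP; field.
Qed.

(** Cutting along the sides of a small square around [p] leaves only that square, by [goursat] on
    the other pieces. There continuity bounds [f], while the perimeter tends to 0. *)
Lemma goursat_punctured a b c d f (p : Cplx R) :
  a < complex.Re p < b -> c < complex.Im p < d ->
  continuous_on (rect a b c d) f ->
  (forall z, rect a b c d z -> z != p -> derivable f z 1) -> rect_integral a b c d f = 0.
Proof.
case: p => x y /= /andP[ax xb] /andP[cy yd] cf df; set p : Cplx R := Complex x y in df.
have pin : rect a b c d p by split => /=; rewrite ?ltW.
have /continuous_cmodP/(_ 1 ltr01)[r r0 rf] := cf _ pin.
pose m := Num.min (Num.min (x - a) (b - x)) (Num.min (y - c) (d - y)).
have m0 : 0 < m by rewrite !lt_min !subr_gt0 ax xb cy yd.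
pose M := cmod (f p) + 1.
have M0 : 0 < M by rewrite ltr_wpDl ?cmod_ge0.
(* The square has half-side [s], hence the bound 4 M (2 s + 2 s); its points are within 2 s of
   [p]. *)
suff small s : 0 < s -> s < m -> 2 * s < r -> cmod (rect_integral a b c d f) <= 16 * M * s.
  apply: cmod_eq0; apply/eqP; rewrite eq_le cmod_ge0 andbT.
  apply/ler_addgt0Pl => e e0; rewrite addr0.
  pose s := Num.min (m / 2) (Num.min (r / 4) (e / (16 * M))).
  have s0 : 0 < s by rewrite !lt_min !divr_gt0 // mulr_gt0.
  have [sm sr se] : [/\ s <= m / 2, s <= r / 4 & s <= e / (16 * M)].
    by split; rewrite !ge_min lexx ?orbT.
  apply: le_trans (small s s0 _ _) _; [lra|lra|].
  by rewrite mulrC -ler_pdivlMr // mulr_gt0.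
move=> s0 sm sr.
have [s1 s2 s3 s4] : [/\ a < x - s, x + s < b, c < y - s & y + s < d].
  move: sm; rewrite !lt_min => /andP[/andP[h1 h2] /andP[h3 h4]].
  by split; lra.
have sub x1 x2 y1 y2 z : a <= x1 -> x2 <= b -> c <= y1 -> y2 <= d ->
    rect x1 x2 y1 y2 z -> rect a b c d z.
  move=> ax1 x2b cy1 y2d [/andP[zx zx'] /andP[zy zy']]; split.
    by rewrite (le_trans ax1 zx) (le_trans zx' x2b).
  by rewrite (le_trans cy1 zy) (le_trans zy' y2d).
have subc x1 x2 y1 y2 : a <= x1 -> x2 <= b -> c <= y1 -> y2 <= d ->
    continuous_on (rect x1 x2 y1 y2) f.
  by move=> ax1 x2b cy1 y2d z /sub zin; apply/cf/zin.
have zero x1 x2 y1 y2 : x1 <= x2 -> y1 <= y2 -> a <= x1 -> x2 <= b -> c <= y1 ->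
    y2 <= d -> [\/ x < x1, x2 < x, y < y1 | y2 < y] -> rect_integral x1 x2 y1 y2 f = 0.
  move=> x12 y12 ax1 x2b cy1 y2d out; apply: goursat => // z zin.
  apply: df; first exact: sub zin.
  apply/eqP => zp; move: zin; rewrite zp => -[/andP[/= h1 h2] /andP[h3 h4]].
  by case: out => h; lra.
rewrite (@rect_integral_split_x _ a (x - s)) //; [|by apply/andP; split; lra|lra].
rewrite (@rect_integral_split_x _ (x - s) (x + s)) //;
  [|by apply/andP; split; lra|lra|by apply: subc; lra].
rewrite (@rect_integral_split_y _ (x - s) (x + s) c (y - s)) //;
  [|lra|by apply/andP; split; lra|by apply: subc; lra].
rewrite (@rect_integral_split_y _ (x - s) (x + s) (y - s) (y + s)) //;
  [|lra|by apply/andP; split; lra|by apply: subc; lra].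
rewrite (zero a) //; try lra; last by apply: Or42; lra.
rewrite (zero (x + s)) //; try lra; last by apply: Or41; lra.
rewrite (zero (x - s) (x + s) c) //; try lra; last by apply: Or44; lra.
rewrite (zero (x - s) (x + s) (y + s)) //; try lra; last by apply: Or43; lra.
rewrite !add0r !addr0.
have cs : continuous_on (frame (x - s) (x + s) (y - s) (y + s)) f.
  by apply/rect_continuous/subc; lra.
have xs : x - s <= x + s by lra.
have ys : y - s <= y + s by lra.
have fM z : frame (x - s) (x + s) (y - s) (y + s) z -> cmod (f z) <= M.
  move=> [/andP[zx zx'] /andP[zy zy'] _].
  have zp : cmod (z - p) <= s + s.
    apply: le_trans (cmod_le_ReIm _) _; rewrite ReD ImD ReN ImN /=.
    by apply: lerD; rewrite ler_norml; apply/andP; split; lra.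
  have /rf : cmod (z - p) < r by apply: le_lt_trans zp _; lra.
  have := cmodD (f z - f p) (f p); rewrite subrK /M; lra.
apply: le_trans (cmod_rect_integral xs ys cs fM) _.
by rewrite le_eqVlt; apply/orP; left; apply/eqP; ring.
Qed.

End Goursat.

(** * Mean value inequality, Cauchy kernels and differentiation under the integral sign *)

Section CauchyFormula.
Context {R : realType}.
Implicit Types (a b c d s r e M B : R) (f : Cplx R -> Cplx R) (p q w z k l : Cplx R).

Lemma is_derive_cst k z : is_derive z 1 (fun=> k) 0.
Proof.
apply/is_derive_cmodP => e e0; exists 1 => // s _.
by rewrite subrr sub0r mul0r oppr0 cmod0 mulr_ge0 ?cmod_ge0 // ltW.
Qed.

Lemma is_derive_scale k f z l : is_derive z 1 f l -> is_derive z 1 (fun w => k * f w) (k * l).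
Proof.
move=> /is_derive_cmodP H; apply/is_derive_cmodP => e e0.
have k1 : 0 < cmod k + 1 by rewrite ltr_wpDl ?cmod_ge0.
have [r r0 rP] := H _ (divr_gt0 e0 k1).
exists r => // w wr; rewrite -mulrA -!mulrBr cmodM.
apply: le_trans (_ : (cmod k + 1) * cmod (f w - f z - l * (w - z)) <= _).
  by rewrite ler_wpM2r ?cmod_ge0 // lerDl.
by rewrite mulrC -ler_pdivlMr // mulrAC; exact: rP.
Qed.

Lemma is_derive_add f g z l k : is_derive z 1 f l -> is_derive z 1 g k ->
  is_derive z 1 (fun w => f w + g w) (l + k).
Proof. exact: is_deriveD. Qed.

Lemma is_derive_near f g z l r : 0 < r ->
  (forall w, cmod (w - z) < r -> f w = g w) -> is_derive z 1 g l -> is_derive z 1 f l.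
Proof.
move=> r0 fg /is_derive_cmodP H; apply/is_derive_cmodP => e /H[r' r'0 rP].
exists (Num.min r r') => [|w]; first by rewrite lt_min r0.
rewrite lt_min => /andP[/fg -> /rP]; rewrite fg //.
by rewrite subrr cmod0.
Qed.

Lemma derive1_eq f z l : is_derive z 1 f l -> derive1 f z = l.
Proof. by move=> [_ <-]; exact: derive1E. Qed.

(** The real mean value theorem is applied to the real and imaginary parts along the segment. Their
    intermediate points [t1] and [t2] may differ, hence the factor 2. *)
Lemma cmod_mean_value f w z M :
  (forall t : R, 0 <= t <= 1 -> exists2 l, is_derive (w + Complex t 0 * (z - w)) 1 f l &
     cmod l <= M) ->
  cmod (f z - f w) <= 2 * M * cmod (z - w).
Proof.
move=> H.
pose l (t : R) := 'D_1 f (w + Complex t 0 * (z - w)) : Cplx R.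
have lP (t : R) : 0 <= t <= 1 ->
    is_derive (w + Complex t 0 * (z - w)) 1 f (l t) /\ cmod (l t) <= M.
  by move=> /H[k dk kM]; rewrite /l; have [_ ->] := dk.
clearbody l.
have E0 : w + Complex 0 0 * (z - w) = w by rewrite (_ : Complex 0 0 = 0) // mul0r addr0.
have E1 : w + Complex 1 0 * (z - w) = z by rewrite (_ : Complex 1 0 = 1) // mul1r subrKC.
have contd (F : R -> R) (F' : R -> R) : (forall t : R, 0 <= t <= 1 -> is_derive t 1 F (F' t)) ->
    exists2 t : R, 0 <= t <= 1 & F 1 - F 0 = F' t.
  move=> dF; have [||t t01 ->] := @MVT_segment _ F F' 0 1 ler01.
  - by move=> t; rewrite in_itv => /andP[/ltW t0 /ltW t1]; apply: dF; rewrite t0.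
  - apply: seg_continuous_within => t /dF[dFt _].
    exact/differentiable_continuous/derivable1_diffP.
  - by exists t => //; rewrite subr0 mulr1.
have [t1 /lP[_ l1] e1] := contd _ _ (fun t h => (is_derive_path (lP t h).1).1).
have [t2 /lP[_ l2] e2] := contd _ _ (fun t h => (is_derive_path (lP t h).1).2).
rewrite E0 E1 in e1 e2.
apply: le_trans (cmod_le_ReIm _) _; rewrite ReD ImD ReN ImN e1 e2.
have h1 := ler_wpM2r (cmod_ge0 (z - w)) l1.
have h2 := ler_wpM2r (cmod_ge0 (z - w)) l2.
have := Re_le_cmod (l t1 * (z - w)); have := Im_le_cmod (l t2 * (z - w)).
rewrite !cmodM => h3 h4; apply: le_trans (lerD (le_trans h4 h1) (le_trans h3 h2)) _.
by rewrite -mulrA mulr2n mulrDl mul1r.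
Qed.

Lemma cmod_le_inv k s : 0 < s -> s <= cmod k -> cmod k^-1 <= s^-1.
Proof. by move=> s0 sk; rewrite cmodV lef_pV2 // posrE // (lt_le_trans s0). Qed.

Lemma cmod_gt_neq0 k s : 0 < s -> s <= cmod k -> k != 0.
Proof. by move=> s0 sk; apply/eqP => k0; move: sk; rewrite k0 cmod0 leNgt s0. Qed.

Lemma cmod_sub_ge z p q s : s <= cmod (z - p) -> cmod (q - p) < s / 2 ->
  s / 2 <= cmod (z - q).
Proof.
move=> zp qp; have := cmodD (z - q) (q - p); rewrite addrA subrK; lra.
Qed.

(** The remainder is exactly (q - p)^2 / ((z - q) (z - p)^2), and both distances to [z] are at least
    [s / 2]. The bound is uniform in [z], as differentiation under the integral sign requires. *)
Lemma inverse_kernel_bound z p q s : 0 < s -> s <= cmod (z - p) ->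
  cmod (q - p) < s / 2 ->
  cmod ((z - q)^-1 - (z - p)^-1 - (q - p) * (z - p)^-1 ^+ 2)
    <= (s / 2)^-1 ^+ 3 * cmod (q - p) ^+ 2.
Proof.
move=> s0 zp qp; have s20 : 0 < s / 2 by rewrite divr_gt0.
have zq := cmod_sub_ge zp qp.
have zp' : s / 2 <= cmod (z - p) by apply: le_trans zp; lra.
have zp0 := cmod_gt_neq0 s0 zp; have zq0 := cmod_gt_neq0 s20 zq.
have -> : (z - q)^-1 - (z - p)^-1 - (q - p) * (z - p)^-1 ^+ 2 =
    (z - q)^-1 * ((z - p)^-1 * (z - p)^-1) * ((q - p) * (q - p)).
  by field; rewrite zp0 zq0.
have i1 := cmod_le_inv s20 zq; have i2 := cmod_le_inv s20 zp'.
rewrite !cmodM -[cmod (q - p) * _]expr2.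
rewrite ler_wpM2r ?sqr_ge0 // exprS expr2.
by rewrite !ler_pM ?mulr_ge0 ?cmod_ge0.
Qed.

(** Again the remainder factors exactly; the new factor 1 / (z - q) + 2 / (z - p) accounts for
    [3 * (s / 2)^-1]. *)
Lemma inverse_square_kernel_bound z p q s : 0 < s -> s <= cmod (z - p) ->
  cmod (q - p) < s / 2 ->
  cmod ((z - q)^-1 ^+ 2 - (z - p)^-1 ^+ 2 - (q - p) * (2 * (z - p)^-1 ^+ 3))
    <= (s / 2)^-1 ^+ 3 * (3 * (s / 2)^-1) * cmod (q - p) ^+ 2.
Proof.
move=> s0 zp qp; have s20 : 0 < s / 2 by rewrite divr_gt0.
have zq := cmod_sub_ge zp qp.
have zp' : s / 2 <= cmod (z - p) by apply: le_trans zp; lra.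
have zp0 := cmod_gt_neq0 s0 zp; have zq0 := cmod_gt_neq0 s20 zq.
have -> : (z - q)^-1 ^+ 2 - (z - p)^-1 ^+ 2 - (q - p) * (2 * (z - p)^-1 ^+ 3) =
    (z - q)^-1 * ((z - p)^-1 * (z - p)^-1) *
    ((z - q)^-1 + ((z - p)^-1 + (z - p)^-1)) * ((q - p) * (q - p)).
  by field; rewrite zp0 zq0.
have i1 := cmod_le_inv s20 zq; have i2 := cmod_le_inv s20 zp'.
rewrite !cmodM -[cmod (q - p) * _]expr2.
rewrite ler_wpM2r ?sqr_ge0 //; apply: ler_pM; rewrite ?mulr_ge0 ?cmod_ge0 //.
  by rewrite exprS expr2 !ler_pM ?mulr_ge0 ?cmod_ge0.
have := cmodD (z - q)^-1 ((z - p)^-1 + (z - p)^-1).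
have := cmodD (z - p)^-1 (z - p)^-1; lra.
Qed.

Lemma is_derive_quadratic f p l B r : 0 < r ->
  (forall q, cmod (q - p) < r ->
     cmod (f q - f p - l * (q - p)) <= B * cmod (q - p) ^+ 2) ->
  is_derive p 1 f l.
Proof.
move=> r0 fB; apply/is_derive_cmodP => e e0.
have B1 : 0 < `|B| + 1 by rewrite ltr_wpDl.
exists (Num.min r (e / (`|B| + 1))) => [|q]; first by rewrite lt_min r0 divr_gt0.
rewrite lt_min => /andP[/fB fq qe]; apply: le_trans fq _.
rewrite expr2 mulrA ler_wpM2r ?cmod_ge0 //.
apply: le_trans (_ : (`|B| + 1) * cmod (q - p) <= _).
  rewrite ler_wpM2r ?cmod_ge0 //; have := ler_norm B; lra.
by rewrite mulrC -ler_pdivlMr // ltW.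
Qed.

(** Writing [p - z] removes the sign from the derivative, so the function is directly a primitive of
    the squared kernel in [winding_constant]. *)
Lemma is_derive_inverse z p : z != p -> is_derive z 1 (fun z => (p - z)^-1) ((z - p)^-1 ^+ 2).
Proof.
move=> zp; have s0 : 0 < cmod (p - z) by rewrite cmod_gt0 // subr_eq0 eq_sym.
apply: (@is_derive_quadratic _ _ _ ((cmod (p - z) / 2)^-1 ^+ 3) (cmod (p - z) / 2)).
  by rewrite divr_gt0.
have -> : (z - p)^-1 ^+ 2 = (p - z)^-1 ^+ 2 by rewrite -opprB invrN sqrrN.
by move=> q qz; rewrite [_ * (q - z)]mulrC; exact: inverse_kernel_bound.
Qed.

(** A remainder quadratic in [q - p], uniformly on the frame, integrates to a remainder of the same
    kind. *)
Lemma is_derive_rect_integral a b c d (K : Cplx R -> Cplx R -> Cplx R) (K' : Cplx R -> Cplx R) p B r :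
  a <= b -> c <= d -> 0 < r ->
  (forall q, cmod (q - p) < r -> continuous_on (frame a b c d) (K q)) ->
  continuous_on (frame a b c d) K' ->
  (forall q z, cmod (q - p) < r -> frame a b c d z ->
     cmod (K q z - K p z - (q - p) * K' z) <= B * cmod (q - p) ^+ 2) ->
  is_derive p 1 (fun q => rect_integral a b c d (K q)) (rect_integral a b c d K').
Proof.
move=> ab cd r0 cK cK' KB.
apply: (@is_derive_quadratic _ _ _ (4 * B * ((b - a) + (d - c))) r) => // q qr.
have cKp : continuous_on (frame a b c d) (K p) by apply: cK; rewrite subrr cmod0.
have cKq := cK _ qr.
have cp : continuous_on (frame a b c d) (fun z => -1 * K p z).
  by move=> z zf; apply: continuous_mul; [exact: continuous_cst|exact: cKp].
have cl : continuous_on (frame a b c d) (fun z => (- (q - p)) * K' z).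
  by move=> z zf; apply: continuous_mul; [exact: continuous_cst|exact: cK'].
have cs : continuous_on (frame a b c d) (fun z => K q z + -1 * K p z).
  by move=> z zf; apply: continuous_add; [exact: cKq|exact: cp].
have -> : rect_integral a b c d (K q) - rect_integral a b c d (K p) - rect_integral a b c d K' * (q - p) =
    rect_integral a b c d (fun z => K q z + -1 * K p z + (- (q - p)) * K' z).
  by rewrite !rect_integral_add // !rect_integral_scale //; ring.
rewrite (_ : 4 * B * _ * _ = 4 * (B * cmod (q - p) ^+ 2) * ((b - a) + (d - c))).
  apply: (cmod_rect_integral ab cd).
    by move=> z zf; apply: continuous_add; [exact: cs|exact: cl].
  by move=> z zf; rewrite mulN1r mulNr; exact: KB.
by ring.
Qed.

End CauchyFormula.

(** * Cauchy's integral formula on squares *)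

Section CauchySquare.
Context {R : realType}.
Implicit Types (s r M : R) (f : Cplx R -> Cplx R) (p q w z : Cplx R).
Local Notation Re := (@complex.Re R).
Local Notation Im := (@complex.Im R).

Definition square_integral w s f : Cplx R := rect_integral (Re w - s) (Re w + s) (Im w - s) (Im w + s) f.
Definition square_frame w s := frame (Re w - s) (Re w + s) (Im w - s) (Im w + s).
Definition square w s := rect (Re w - s) (Re w + s) (Im w - s) (Im w + s).

Lemma square_frame_far w s z : 0 < s -> square_frame w s z -> s <= cmod (z - w).
Proof.
move=> s0 [_ _ zw].
have hR := Re_le_cmod (z - w); have hI := Im_le_cmod (z - w).
move: hR hI; rewrite ReD ImD ReN ImN !ler_norml => /andP[h1 h2] /andP[h3 h4].
by case: zw => E; move: h1 h2 h3 h4; rewrite E; lra.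
Qed.

Lemma square_cmod w s z : square w s z -> cmod (z - w) <= s + s.
Proof.
move=> [/andP[h1 h2] /andP[h3 h4]]; apply: le_trans (cmod_le_ReIm _) _.
rewrite ReD ImD ReN ImN; apply: lerD; rewrite ler_norml; apply/andP; split; lra.
Qed.

Lemma ball_square w s p : cmod (p - w) < s ->
  Re w - s < Re p < Re w + s /\ Im w - s < Im p < Im w + s.
Proof.
move=> pw; have := le_lt_trans (Re_le_cmod _) pw; have := le_lt_trans (Im_le_cmod _) pw.
rewrite ReD ImD ReN ImN !ltr_norml => /andP[h1 h2] /andP[h3 h4].
by split; apply/andP; split; lra.
Qed.

Lemma is_derive_mul f (g : Cplx R -> Cplx R) z (l k : Cplx R) :
  is_derive z 1 f l -> is_derive z 1 g k ->
  is_derive z 1 (fun w => f w * g w) (f z * k + g z * l).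
Proof. exact: is_deriveM. Qed.

Lemma square_frame_neq w s p z : cmod (p - w) < s -> square_frame w s z -> z != p.
Proof.
move=> pw zf; apply/eqP => zp; move: zf; rewrite zp => zf.
have s0 := le_lt_trans (cmod_ge0 _) pw.
by have := square_frame_far s0 zf; rewrite leNgt pw.
Qed.

Section Center.
Variables (w : Cplx R) (s : R).
Hypothesis s0 : 0 < s.
Let xs : Re w - s <= Re w + s. Proof. by move: s0; lra. Qed.
Let ys : Im w - s <= Im w + s. Proof. by move: s0; lra. Qed.

Lemma continuous_kernel f p n : cmod (p - w) < s ->
  continuous_on (square_frame w s) f ->
  continuous_on (square_frame w s) (fun z => f z * (z - p)^-1 ^+ n).
Proof.
move=> pw cf z zf; apply: continuous_mul; first exact: cf.
elim: n => [|n IH]; first exact: continuous_cst.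
have -> : (fun z => (z - p)^-1 ^+ n.+1) = (fun z => (z - p)^-1 * (z - p)^-1 ^+ n).
  by apply/funext => y; rewrite exprS.
apply: continuous_mul IH.
apply: continuous_inv; last exact: continuous_subr.
by rewrite subr_eq0; exact: square_frame_neq zf.
Qed.

Lemma continuous_difference_quotient f p (l : Cplx R) : is_derive p 1 f l ->
  {for p, continuous (fun z => if z == p then l else (f p - f z) * (p - z)^-1)}.
Proof.
move=> /is_derive_cmodP df; apply/continuous_cmodP => e e0.
have e20 : 0 < e / 2 by rewrite divr_gt0.
have [r r0 rP] := df _ e20.
exists r => // z /rP zr; rewrite eqxx; case: eqVneq => [_|zp].
  by rewrite subrr cmod0.
have zp0 : z - p != 0 by rewrite subr_eq0.
have pz0 : p - z != 0 by rewrite subr_eq0 eq_sym.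
have -> : (f p - f z) * (p - z)^-1 - l = (f z - f p - l * (z - p)) * (z - p)^-1.
  by field; rewrite zp0 pz0.
rewrite cmodM cmodV; apply: le_lt_trans (_ : e / 2 < e); last by lra.
by rewrite ler_pdivrMr // cmod_gt0.
Qed.

Lemma cauchy_formula f p : cmod (p - w) < s ->
  (forall z, square w s z -> derivable f z 1) ->
  f p * square_integral w s (fun z => (z - p)^-1) =
  square_integral w s (fun z => f z * (z - p)^-1).
Proof.
move=> pw df; have [px py] := ball_square pw.
have pin : square w s p.
  by move: px py => /andP[h1 h2] /andP[h3 h4]; split; rewrite !ltW.
have dfp := derivableP (df _ pin).
pose g z := if z == p then 'D_1 f p else (f p - f z) * (p - z)^-1.
have dg z : square w s z -> z != p -> exists l, is_derive z 1 g l.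
  move=> zin zp.
  have zp0 : 0 < cmod (z - p) by rewrite cmod_gt0 // subr_eq0.
  have d1 := is_derive_add (is_derive_cst (f p) z) (is_derive_scale (-1) (derivableP (df _ zin))).
  have d2 := is_derive_mul d1 (is_derive_inverse zp).
  (* The disc of radius [cmod (z - p)] around [z] misses [p], so [g] is given by its second branch
     there. *)
  eexists; apply: is_derive_near zp0 _ d2 => q qz.
  rewrite /g mulN1r; case: eqVneq => // qp.
  by move: qz; rewrite qp cmodB ltxx.
have cg : continuous_on (square w s) g.
  move=> z zin; have [->|zp] := eqVneq z p.
    exact: continuous_difference_quotient dfp.
  by have [l] := dg _ zin zp; exact: is_derive_continuous.
have cf : continuous_on (square_frame w s) f.
  by move=> z /frame_rect/df/derivableP/is_derive_continuous.
have c1 := continuous_kernel (n := 1) pw cf.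
have c0 : continuous_on (square_frame w s) (fun=> 1).
  by move=> z _; exact: continuous_cst.
have c2 := continuous_kernel (n := 1) pw c0.
have c3 : continuous_on (square_frame w s) (fun z => (- f p) * (1 * (z - p)^-1 ^+ 1)).
  by move=> z zf; apply: continuous_mul; [exact: continuous_cst|exact: c2].
have : square_integral w s g = 0.
  apply: (goursat_punctured px py cg) => z zin zp.
  by have [l []] := dg _ zin zp.
have -> : square_integral w s g = square_integral w s
    (fun z => f z * (z - p)^-1 ^+ 1 + (- f p) * (1 * (z - p)^-1 ^+ 1)).
  apply: (eq_rect_integral xs ys) => z zf; have zp := square_frame_neq pw zf.
  have zp0 : z - p != 0 by rewrite subr_eq0.
  have pz0 : p - z != 0 by rewrite subr_eq0 eq_sym.
  by rewrite /g (negPf zp); field; rewrite zp0 pz0.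
have e1 : square_integral w s (fun z => 1 * (z - p)^-1 ^+ 1) =
    square_integral w s (fun z => (z - p)^-1).
  by apply: (eq_rect_integral xs ys) => z _; rewrite mul1r.
have e2 : square_integral w s (fun z => f z * (z - p)^-1 ^+ 1) =
    square_integral w s (fun z => f z * (z - p)^-1).
  by apply: (eq_rect_integral xs ys) => z _; rewrite expr1.
move: e1 e2; rewrite /square_integral (rect_integral_add xs ys c1 c3) (rect_integral_scale xs ys _ c2).
by move=> -> -> /eqP; rewrite mulNr subr_eq0 => /eqP.
Qed.

Lemma frame_half p z : cmod (p - w) < s / 2 -> square_frame w s z -> s / 2 <= cmod (z - p).
Proof. by move=> pw zf; apply: cmod_sub_ge pw; exact: square_frame_far. Qed.

Lemma ball_trans p q : cmod (p - w) < s / 2 -> cmod (q - p) < s / 2 -> cmod (q - w) < s.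
Proof.
move=> pw qp; have := cmodD (q - p) (p - w); rewrite addrA subrK; lra.
Qed.

(** For [p] within [s / 2] of the center, the frame stays at distance at least [s / 2] from [p], so
    the kernel bounds apply with [s / 2] for [s]. *)
Lemma is_derive_kernel1 f M p : continuous_on (square_frame w s) f ->
  (forall z, square_frame w s z -> cmod (f z) <= M) -> cmod (p - w) < s / 2 ->
  is_derive p 1 (fun q => square_integral w s (fun z => f z * (z - q)^-1 ^+ 1))
    (square_integral w s (fun z => f z * (z - p)^-1 ^+ 2)).
Proof.
move=> cf fM pw; have r0 : 0 < s / 2 / 2 by rewrite !divr_gt0.
have s20 : 0 < s / 2 by rewrite divr_gt0.
apply: (is_derive_rect_integral (K := fun q z => f z * (z - q)^-1 ^+ 1)
  (B := M * (s / 2 / 2)^-1 ^+ 3) xs ys r0).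
- move=> q qp; apply: continuous_kernel cf; apply: ball_trans pw _.
  by apply: lt_trans qp _; lra.
- by apply: continuous_kernel cf; apply: lt_trans pw _; lra.
- move=> q z qp zf.
  have -> : f z * (z - q)^-1 ^+ 1 - f z * (z - p)^-1 ^+ 1 - (q - p) * (f z * (z - p)^-1 ^+ 2) =
    f z * ((z - q)^-1 - (z - p)^-1 - (q - p) * (z - p)^-1 ^+ 2) by ring.
  rewrite cmodM -mulrA ler_pM ?cmod_ge0 //; first exact: fM.
  by apply: inverse_kernel_bound => //; exact: frame_half.
Qed.

Lemma is_derive_kernel2 f M p : continuous_on (square_frame w s) f ->
  (forall z, square_frame w s z -> cmod (f z) <= M) -> cmod (p - w) < s / 2 ->
  is_derive p 1 (fun q => square_integral w s (fun z => f z * (z - q)^-1 ^+ 2))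
    (square_integral w s (fun z => 2 * f z * (z - p)^-1 ^+ 3)).
Proof.
move=> cf fM pw; have r0 : 0 < s / 2 / 2 by rewrite !divr_gt0.
have s20 : 0 < s / 2 by rewrite divr_gt0.
apply: (is_derive_rect_integral (K := fun q z => f z * (z - q)^-1 ^+ 2)
  (B := M * ((s / 2 / 2)^-1 ^+ 3 * (3 * (s / 2 / 2)^-1))) xs ys r0).
- move=> q qp; apply: continuous_kernel cf; apply: ball_trans pw _.
  by apply: lt_trans qp _; lra.
- apply: continuous_kernel; first by apply: lt_trans pw _; lra.
  by move=> z /cf; apply: continuous_mul; exact: continuous_cst.
- move=> q z qp zf.
  have -> : f z * (z - q)^-1 ^+ 2 - f z * (z - p)^-1 ^+ 2
      - (q - p) * (2 * f z * (z - p)^-1 ^+ 3) =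
    f z * ((z - q)^-1 ^+ 2 - (z - p)^-1 ^+ 2 - (q - p) * (2 * (z - p)^-1 ^+ 3)) by ring.
  rewrite cmodM -mulrA ler_pM ?cmod_ge0 //; first exact: fM.
  by apply: inverse_square_kernel_bound => //; exact: frame_half.
Qed.

(** As a function of [p] the integral has as derivative the integral of (z - p)^-2, which vanishes
    because this kernel has a primitive along the frame. *)
Lemma winding_constant p : cmod (p - w) < s / 2 ->
  square_integral w s (fun z => (z - p)^-1) = square_integral w s (fun z => (z - w)^-1).
Proof.
move=> pw.
pose F q := square_integral w s (fun z => 1 * (z - q)^-1 ^+ 1).
have FE q : square_integral w s (fun z => (z - q)^-1) = F q.
  by apply: (eq_rect_integral xs ys) => z _; rewrite mul1r.
have dF q : cmod (q - w) < s / 2 -> is_derive q 1 F 0.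
  move=> qw; have qs : cmod (q - w) < s by apply: lt_trans qw _; move: s0; lra.
  have c1 : continuous_on (square_frame w s) (fun=> 1).
    by move=> z _; exact: continuous_cst.
  have := @is_derive_kernel1 (fun=> 1) 1 q c1 _ qw; rewrite {1}cmod1 => /(_ (fun _ _ => lexx _)).
  suff -> : square_integral w s (fun z => 1 * (z - q)^-1 ^+ 2) = 0 by [].
  apply: (rect_integral_primitive xs ys (P := fun z => (q - z)^-1)).
    exact: continuous_kernel.
  move=> z zf; rewrite mul1r; apply: is_derive_inverse.
  exact: square_frame_neq zf.
apply/eqP; rewrite -subr_eq0; apply/eqP/cmod_eq0/eqP.
rewrite eq_le cmod_ge0 andbT !FE.
have := @cmod_mean_value _ F w p 0; rewrite mulr0 mul0r; apply => t /andP[t0 t1].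
exists 0; last by rewrite cmod0.
apply: dF; rewrite addrAC subrr add0r cmodM cmod_real ger0_norm //.
by apply: le_lt_trans pw; rewrite ler_piMl ?cmod_ge0.
Qed.

End Center.
End CauchySquare.

(** * Lower bound for the winding integral and Cauchy's estimate *)

Section CauchyEstimate.
Context {R : realType}.
Implicit Types (s r t M : R) (f : Cplx R -> Cplx R) (p q w z : Cplx R).
Local Notation Re := (@complex.Re R).
Local Notation Im := (@complex.Im R).

(** The denominator is at most 2 s^2. Integrated over an edge of length 2 s, the bound yields the 1
    that each of the four edges contributes to [winding_lower_bound]. *)
Lemma inverse_le_quotient s t : 0 < s -> - s <= t <= s ->
  (s + s)^-1 <= s / (t ^+ 2 + s ^+ 2).
Proof.
move=> s0 /andP[t1 t2].
have ts : t ^+ 2 <= s ^+ 2 by rewrite -subr_ge0 subr_sqr mulr_ge0 //; lra.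
have h0 : 0 < t ^+ 2 + s ^+ 2 by rewrite ltr_wpDl ?sqr_ge0 ?exprn_gt0.
rewrite ler_pdivlMr // mulrC ler_pdivrMr ?addr_gt0 //.
by rewrite mulrDr -expr2 lerD2r.
Qed.

(* The imaginary part of dz / (z - w) is |s| dt / |z - w|^2 along each edge. *)
Lemma winding_lower_bound w s : 0 < s ->
  4 <= Im (square_integral w s (fun z => (z - w)^-1)).
Proof.
case: w => x y s0.
have xs : x - s <= x + s by move: s0; lra.
have ys : y - s <= y + s by move: s0; lra.
pose w : Cplx R := Complex x y.
have cf : continuous_on (square_frame w s) (fun z => (z - w)^-1).
  move=> z zf; apply: continuous_inv; last exact: continuous_subr.
  rewrite subr_eq0; apply: square_frame_neq zf.
  by rewrite subrr cmod0.
have [c1 c2 c3 c4] := edges_continuous xs ys cf.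
have ccst k (a b : R) : seg_continuous a b (fun=> k : R) by move=> t _; exact: cst_continuous.
have s20 : s + s != 0 by rewrite lt0r_neq0 // addr_gt0.
have cstE k (u : R) : rintegral (u - s) (u + s) (fun=> k) = k * (s + s).
  by rewrite rintegral_cst; [ring|move: s0; lra].
have one (u : R) : 1 = rintegral (u - s) (u + s) (fun=> (s + s)^-1).
  by rewrite cstE mulVf.
have oneN (u : R) : -1 = rintegral (u - s) (u + s) (fun=> - (s + s)^-1).
  by rewrite cstE mulNr mulVf.
have invE (a b : R) : (Complex a b : Cplx R)^-1 =
    Complex (a / (a ^+ 2 + b ^+ 2)) (- (b / (a ^+ 2 + b ^+ 2))) by [].
have subE (a b : R) : Complex a b - w = Complex (a - x) (b - y) by [].
have E1 (u : R) : u - s - u = - s by rewrite addrAC subrr add0r.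
have E2 (u : R) : u + s - u = s by rewrite addrAC subrr add0r.
have rng (u t : R) : u - s <= t <= u + s -> - s <= t - u <= s.
  by move=> /andP[h1 h2]; apply/andP; split; lra.
have h1 : 1 <= rintegral (x - s) (x + s) (fun t => Im ((Complex t (y - s) - w)^-1)).
  rewrite (one x); apply: rintegral_le; [exact: ccst|exact: (seg_continuous_Im c1)|].
  move=> t /rng th; rewrite subE invE E1 /= sqrrN mulNr opprK.
  exact: inverse_le_quotient.
(* On vertical edges the factor [ci] turns the real part of the integral into the imaginary part of
   the contribution. *)
have h2 : 1 <= rintegral (y - s) (y + s) (fun t => Re ((Complex (x + s) t - w)^-1)).
  rewrite (one y); apply: rintegral_le; [exact: ccst|exact: (seg_continuous_Re c2)|].
  move=> t /rng th; rewrite subE invE E2 /= [s ^+ 2 + _]addrC.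
  exact: inverse_le_quotient.
have h3 : rintegral (x - s) (x + s) (fun t => Im ((Complex t (y + s) - w)^-1)) <= -1.
  rewrite (oneN x); apply: rintegral_le; [exact: (seg_continuous_Im c3)|exact: ccst|].
  move=> t /rng th; rewrite subE invE E2 /= lerN2.
  exact: inverse_le_quotient.
have h4 : rintegral (y - s) (y + s) (fun t => Re ((Complex (x - s) t - w)^-1)) <= -1.
  rewrite (oneN y); apply: rintegral_le; [exact: (seg_continuous_Re c4)|exact: ccst|].
  move=> t /rng th; rewrite subE invE E1 /= sqrrN mulNr lerN2 [s ^+ 2 + _]addrC.
  exact: inverse_le_quotient.
rewrite /square_integral /rect_integral !ImD !ImN /=.
by move: h1 h2 h3 h4; rewrite !mul0r !mul1r !add0r; lra.
Qed.

Lemma cauchy_estimate w s f M : 0 < s ->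
  (forall z, square w s z -> derivable f z 1) ->
  (forall z, square w s z -> cmod (f z) <= M) ->
  derivable (derive1 f) w 1 /\ cmod (derive1 f w) <= 4 * M / s.
Proof.
move=> s0 df fM.
have xs : Re w - s <= Re w + s by move: s0; lra.
have ys : Im w - s <= Im w + s by move: s0; lra.
have s20 : 0 < s / 2 by rewrite divr_gt0.
pose C := square_integral w s (fun z => (z - w)^-1).
have C4 : 4 <= cmod C.
  apply: le_trans (winding_lower_bound w s0) _.
  by apply: le_trans (Im_le_cmod _); exact: ler_norm.
have C0 : C != 0 by apply: cmod_gt_neq0 C4.
have cf : continuous_on (square_frame w s) f.
  by move=> z /frame_rect/df/derivableP/is_derive_continuous.
have fMf z : square_frame w s z -> cmod (f z) <= M by move=> /frame_rect/fM.
pose S n q := square_integral w s (fun z => f z * (z - q)^-1 ^+ n).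
have fE p : cmod (p - w) < s / 2 -> f p = C^-1 * S 1%N p.
  move=> pw; have pw' : cmod (p - w) < s by apply: lt_trans pw _; move: s0; lra.
  have := cauchy_formula s0 pw' df; rewrite (winding_constant s0 pw) -/C => h.
  have -> : S 1%N p = f p * C.
    by rewrite h; apply: (eq_rect_integral xs ys) => z _; rewrite expr1.
  by rewrite mulrC mulfK.
have dfE p : cmod (p - w) < s / 2 -> is_derive p 1 f (C^-1 * S 2%N p).
  move=> pw; have r0 : 0 < s / 2 - cmod (p - w) by rewrite subr_gt0.
  apply: (is_derive_near r0 _ (is_derive_scale C^-1 (is_derive_kernel1 s0 cf fMf pw))).
  move=> q qp; apply: fE; have := cmodD (q - p) (p - w).
  by rewrite addrA subrK; move: qp; lra.
have ww : cmod (w - w) < s / 2 by rewrite subrr cmod0.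
split.
  have [] : is_derive w 1 (derive1 f)
      (C^-1 * square_integral w s (fun z => 2 * f z * (z - w)^-1 ^+ 3)).
    apply: (is_derive_near s20 _ (is_derive_scale C^-1 (is_derive_kernel2 s0 cf fMf ww))).
    by move=> q qw; apply: derive1_eq; exact: dfE.
  by [].
rewrite (derive1_eq (dfE _ ww)) cmodM cmodV.
have c2 : continuous_on (square_frame w s) (fun z => f z * (z - w)^-1 ^+ 2).
  by apply: continuous_kernel cf; rewrite subrr cmod0.
have SM : cmod (S 2%N w) <= 4 * (M * (s^-1 * s^-1)) * ((s + s) + (s + s)).
  have := @cmod_rect_integral R _ _ _ _ xs ys _ (M * (s^-1 * s^-1)) c2.
  rewrite (_ : Re w + s - _ + (Im w + s - _) = (s + s) + (s + s)); last by ring.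
  apply => z zf; rewrite cmodM expr2 cmodM ler_pM ?mulr_ge0 ?cmod_ge0 ?fMf //.
  have zw := cmod_le_inv s0 (square_frame_far s0 zf).
  by rewrite ler_pM ?cmod_ge0.
(* Here 1 / 4 bounds the inverse of [C], M / s^2 the integrand, and 4 (s + s + s + s) comes from
   [cmod_rect_integral]; the product is 4 M / s. *)
apply: le_trans (_ : 4^-1 * (4 * (M * (s^-1 * s^-1)) * ((s + s) + (s + s))) <= _).
  apply: ler_pM SM; rewrite ?invr_ge0 ?cmod_ge0 //.
  by rewrite lef_pV2 // posrE // (lt_le_trans _ C4).
by rewrite le_eqVlt; apply/orP; left; apply/eqP; field; rewrite gt_eqF.
Qed.

End CauchyEstimate.

(** * Iterated derivatives of holomorphic functions *)

Section HolomorphicFunctions.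
Context {R : realType}.
Variable Omega : set (Cplx R).
Hypothesis Omega_open : open Omega.
Implicit Types (f g : Cplx R -> Cplx R) (w z c : Cplx R) (r M : R).

Lemma open_cmod_ball w : Omega w ->
  exists2 r : R, 0 < r & forall z, cmod (z - w) < r -> Omega z.
Proof. by move=> ow; apply/nbhs_cmodP; exact: open_nbhs_nbhs. Qed.

Lemma square_in_ball w s r z : s + s < r -> square w s z -> cmod (z - w) < r.
Proof. by move=> sr /square_cmod; move: sr; lra. Qed.

Lemma holomorphic_derive1 f :
  holomorphic_on Omega f -> holomorphic_on Omega (derive1 f).
Proof.
move=> hf w ow; have [r r0 rO] := open_cmod_ball ow.
have cf : {for w, continuous f}.
  exact: (is_derive_continuous (derivableP (hf _ ow))).
have [r' r'0 rf] := (continuous_cmodP f w).1 cf _ ltr01.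
(* The square of half-side [s] lies in a disc of radius 2 s, hence both in [Omega] and where
   continuity bounds [f] by [cmod (f w) + 1]. *)
pose s := Num.min (r / 4) (r' / 4).
have s0 : 0 < s by rewrite lt_min !divr_gt0.
have [sr sr'] : s + s < r /\ s + s < r'.
  have h1 : s <= r / 4 by rewrite /s ge_min lexx.
  have h2 : s <= r' / 4 by rewrite /s ge_min lexx orbT.
  by split; lra.
have df z : square w s z -> derivable f z 1.
  by move=> /(square_in_ball sr)/rO/hf.
have fM z : square w s z -> cmod (f z) <= cmod (f w) + 1.
  move=> /(square_in_ball sr')/rf; have := cmodD (f z - f w) (f w).
  by rewrite subrK; lra.
exact: (cauchy_estimate s0 df fM).1.
Qed.

Lemma holomorphic_derive1n f k :
  holomorphic_on Omega f -> holomorphic_on Omega (derive1n k f).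
Proof.
move=> hf; elim: k => [|k IH]; first exact: hf.
by rewrite /holomorphic_on derive1nS; exact: holomorphic_derive1.
Qed.

(** Linearity holds on [Omega] only. The induction differentiates the identity of order [k], valid
    on a disc around [w] because [Omega] is open. *)
Lemma derive1n_add_scale f g c k w :
  holomorphic_on Omega f -> holomorphic_on Omega g -> Omega w ->
  derive1n k (fun z => f z + c * g z) w = derive1n k f w + c * derive1n k g w.
Proof.
move=> hf hg; elim: k w => [|k IH] w ow; first by [].
have [r r0 rO] := open_cmod_ball ow.
have df := derivableP (holomorphic_derive1n (k := k) hf ow).
have dg := derivableP (holomorphic_derive1n (k := k) hg ow).
rewrite !derive1nS; apply: derive1_eq.
rewrite (derive1_eq df) (derive1_eq dg).
apply: (is_derive_near r0 _ (is_derive_add df (is_derive_scale c dg))).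
by move=> z /rO/IH.
Qed.

Lemma bounded_cmodP f :
  [bounded f w | w in Omega] <-> exists M, forall w, Omega w -> cmod (f w) <= M.
Proof.
split=> [[M [Mr Mf]]|[M fM]].
  have M1 : M < M + 1 by rewrite ltrDl ltr01.
  exists (complex.Re (M + 1)) => w ow.
  have := Mf _ M1 w ow; rewrite /= normE lecE => /andP[_ /=].
  by [].
exists (Complex M 0); split; first by rewrite complex_real.
move=> x Mx w ow /=; apply: le_trans (ltW Mx).
by rewrite normE lecR; exact: fM.
Qed.

End HolomorphicFunctions.

(** * Evaluations of derivatives dominated by finitely many seminorms *)

Section Evaluation.
Context {R : realType}.
Variables (Omega : set (Cplx R)) (F I : set nat) (pt : nat -> Cplx R).
Hypothesis Omega_open : open Omega.
Implicit Types (f g : Cplx R -> Cplx R) (w z c : Cplx R) (r M C e : R)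
  (S : set ((Cplx R -> Cplx R) -> R)).
Local Notation HF := (HFinfty_set Omega F).
Local Notation seminorms := (HFinfty_seminorms Omega F I pt).

Lemma HFinfty_set_add_scale f g c : HF f -> HF g -> HF (fun z => f z + c * g z).
Proof.
move=> [hf f0 bf] [hg g0 bg]; split.
- move=> w ow.
  by have [] := is_derive_add (derivableP (hf _ ow)) (is_derive_scale c (derivableP (hg _ ow))).
- by move=> w ow; rewrite f0 // g0 // mulr0 addr0.
- move=> k Fk; apply/bounded_cmodP.
  have [M fM] := (bounded_cmodP _ _).1 (bf _ Fk).
  have [N gN] := (bounded_cmodP _ _).1 (bg _ Fk).
  exists (M + cmod c * N) => w ow.
  rewrite (derive1n_add_scale Omega_open) //.
  apply: le_trans (cmodD _ _) _; rewrite cmodM.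
  by apply: lerD; [exact: fM|rewrite ler_wpM2l ?cmod_ge0 //; exact: gN].
Qed.

Lemma cmod_le_sup_seminorm f k w : HF f -> F k -> Omega w ->
  cmod (derive1n k f w) <= sup_seminorm Omega k f.
Proof.
move=> [_ _ bf] Fk ow; have [M fM] := (bounded_cmodP _ _).1 (bf _ Fk).
by apply: ub_le_sup; [exists M => _ [z oz <-]; exact: fM|exists w].
Qed.

Lemma sup_seminorm_le f k M w : Omega w ->
  (forall z, Omega z -> cmod (derive1n k f z) <= M) -> sup_seminorm Omega k f <= M.
Proof.
by move=> ow fM; apply: ge_sup; [exists (cmod (derive1n k f w)); exists w|move=> _ [z oz <-]; exact: fM].
Qed.

(* Continuity at 0 of the evaluation f |-> f^(k)(w), expressed with finitely
   many of the defining seminorms. *)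
Definition dominated k w S C := forall g e, HF g -> 0 < e ->
  (forall p, S p -> p g < e) -> cmod (derive1n k g w) <= C * e.

Definition eval_continuous k w := exists S C,
  [/\ finite_set S, S `<=` seminorms & dominated k w S C].

Definition eval_equicontinuous k w := exists r S C,
  [/\ 0 < r, finite_set S, S `<=` seminorms &
      forall z, cmod (z - w) < r -> Omega z /\ dominated k z S C].

Lemma eval_equicontinuousW k w : eval_equicontinuous k w -> eval_continuous k w.
Proof.
move=> [r [S [C [r0 fS sS H]]]]; exists S, C; split => //.
by have [] := H w; rewrite ?subrr ?cmod0.
Qed.

Lemma eval_equicontinuous_sup k w : F k -> Omega w -> eval_equicontinuous k w.
Proof.
move=> Fk ow; have [r r0 rO] := open_cmod_ball Omega_open ow.
exists r, [set sup_seminorm Omega k], 1; split => //.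
  by move=> p ->; left; exists k.
move=> z /rO oz; split => // g e hg e0 /(_ _ erefl) ge.
by rewrite mul1r; apply: le_trans (ltW ge); exact: cmod_le_sup_seminorm.
Qed.

Lemma eval_continuous_point k i : I i -> (forall j, F j -> (k < j)%N) ->
  eval_continuous k (pt i).
Proof.
move=> Ii kF; exists [set point_seminorm (pt i) k], 1; split => //.
  by move=> p ->; right; exists i, k.
by move=> g e hg e0 /(_ _ erefl) ge; rewrite mul1r ltW.
Qed.

(** For [z] in the half disc, the square of half-side [r / 8] around [z] stays in the disc of radius
    [r]. Cauchy's estimate on it has a constant independent of [z]. *)
Lemma eval_equicontinuous_succ k w :
  eval_equicontinuous k w -> eval_equicontinuous k.+1 w.
Proof.
move=> [r [S [C [r0 fS sS H]]]].
exists (r / 2), S, (4 * C / (r / 8)); split => //; first by rewrite divr_gt0.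
move=> z zw; have zr : cmod (z - w) < r by lra.
split; first exact: (H z zr).1.
move=> g e hg e0 Sg.
have s0 : 0 < r / 8 by rewrite divr_gt0.
have inball y : square z (r / 8) y -> cmod (y - w) < r.
  have sr : r / 8 + r / 8 < r / 2 by lra.
  move=> /(square_in_ball sr) yz; have := cmodD (y - z) (z - w).
  by rewrite addrA subrK; move: yz zw; lra.
have [hol _ _] := hg.
have [_] := @cauchy_estimate R z (r / 8) (derive1n k g) (C * e) s0
  (fun y yz => holomorphic_derive1n Omega_open (k := k) hol (H y (inball y yz)).1)
  (fun y yz => (H y (inball y yz)).2 g e hg e0 Sg).
by rewrite -derive1nS mulrA mulrAC.
Qed.

(* On a disc where f^(k+1) is controlled, the mean value inequality carries a
   bound for f^(k) at a single point z over to the whole disc. *)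
Lemma eval_continuous_propagate k w : eval_equicontinuous k.+1 w ->
  exists2 r : R, 0 < r & forall z, cmod (z - w) < r -> Omega z /\
    (eval_continuous k z -> eval_equicontinuous k w).
Proof.
move=> [r [S [C [r0 fS sS H]]]]; exists r => // z zw.
split; first by have [] := H z zw.
move=> [S' [C' [fS' sS' H']]].
(* The point [y] is reached from [z] through the center [w], so that both segments stay in the disc.
   Each costs [2 * |C| * r * e], and [C] may be negative, hence the absolute value. *)
exists r, (S `|` S'), (C' + 2 * `|C| * r + 2 * `|C| * r); split => //.
- by rewrite finite_setU.
- by rewrite subUset.
move=> y yw; split; first by have [] := H y yw.
move=> g e hg e0 Sg; have [hol _ _] := hg.
have near x : cmod (x - w) < r ->
    cmod (derive1n k g x - derive1n k g w) <= 2 * `|C| * r * e.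
  move=> xw.
  have bd : forall t : R, 0 <= t <= 1 ->
    exists2 l, is_derive (w + Complex t 0 * (x - w)) 1 (derive1n k g) l &
     cmod l <= `|C| * e.
    move=> t /andP[t0 t1].
    have tr : cmod (w + Complex t 0 * (x - w) - w) < r.
      rewrite addrAC subrr add0r cmodM cmod_real ger0_norm //.
      by apply: le_lt_trans xw; rewrite ler_piMl ?cmod_ge0.
    have [oz dz] := H _ tr.
    have dg := derivableP (holomorphic_derive1n Omega_open (k := k) hol oz).
    exists (derive1n k.+1 g (w + Complex t 0 * (x - w))).
      by rewrite derive1nS (derive1_eq dg).
    apply: (le_trans (dz g e hg e0 (fun p Sp => Sg p (or_introl Sp)))).
    by rewrite ler_wpM2r ?ler_norm // ltW.
  apply: le_trans (cmod_mean_value bd) _.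
  rewrite -!mulrA ler_wpM2l // ler_wpM2l // [leRHS]mulrC ler_wpM2l ?(ltW e0) //.
  exact: ltW.
have gz := H' g e hg e0 (fun p Sp => Sg p (or_intror Sp)).
have := near y yw; have := near z zw; rewrite [cmod (_ z - _)]cmodB.
have := cmodD (derive1n k g w - derive1n k g z) (derive1n k g z).
have := cmodD (derive1n k g y - derive1n k g w) (derive1n k g w).
by rewrite !subrK !mulrDl; lra.
Qed.

End Evaluation.

(** * Connectedness argument and continuity of all evaluations *)

Section Components.
Context {R : realType}.
Variables (Omega : set (Cplx R)) (F I : set nat) (Omega_ : nat -> set (Cplx R))
  (pt : nat -> Cplx R).
Hypotheses (Omega_open : open Omega)
  (Omega_comp : components_indexed Omega I Omega_)
  (pt_in : forall i, I i -> Omega_ i (pt i)).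
Implicit Types (w z : Cplx R).
Local Notation eval_continuous := (eval_continuous Omega F I pt).
Local Notation eval_equicontinuous := (eval_equicontinuous Omega F I pt).

Lemma eval_equicontinuous_pred k : (forall j, F j -> (k < j)%N) ->
  (forall w, Omega w -> eval_equicontinuous k.+1 w) ->
  forall w, Omega w -> eval_equicontinuous k w.
Proof.
move=> kF ek w ow; have [_ _ comps] := Omega_comp.
have [i Ii iw] : (Omega_ @` I) (connected_component Omega w) by rewrite comps; exists w.
have ptw : connected_component Omega w (pt i) by rewrite -iw; exact: pt_in.
have sub := @connected_component_sub _ Omega w.
pose A := [set z | Omega z /\ eval_equicontinuous k z].
pose D := [set z | Omega z /\ ~ eval_equicontinuous k z].
have openA : open A.
  rewrite openE => z [oz [r [S [C [r0 fS sS H]]]]]; apply/nbhs_cmodP.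
  exists (r / 2); first by rewrite divr_gt0.
  move=> y yz; have yr : cmod (y - z) < r by apply: lt_trans yz _; lra.
  split; first exact: (H y yr).1.
  exists (r / 2), S, C; split=> //; first by rewrite divr_gt0.
  move=> x xy; apply: H; have := cmodD (x - y) (y - z).
  by rewrite addrA subrK; lra.
(* If some [y] near [z] were outside [D], the evaluation at [y] would be continuous and
   [eval_continuous_propagate] would contradict [nz]. Openness of [D] makes [A] relatively
   closed. *)
have openD : open D.
  rewrite openE => z [oz nz]; apply/nbhs_cmodP.
  have [r r0 H] := eval_continuous_propagate Omega_open (ek _ oz).
  exists r => // y yz; have [oy yH] := H y yz; split => // /eval_equicontinuousW.
  by move=> /yH.
have ccA : connected_component Omega w `&` A = connected_component Omega w.
  apply: (@component_connected _ Omega w).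
  - exists (pt i); split => //; split; first exact: sub.
    (* Propagation from [pt i] to itself upgrades the pointwise control given by the point seminorm
       to a whole disc. *)
    have [r r0 H] := eval_continuous_propagate Omega_open (ek _ (sub _ ptw)).
    apply: (H (pt i) _).2; first by rewrite subrr cmod0.
    exact: eval_continuous_point.
  - by exists A.
  - exists (~` D); first exact: open_closedC.
    apply/seteqP; split => z [cz] => [[_ Az]|nD]; split => //.
      by move=> [].
    by split; [exact: sub|apply: contrapT => nA; apply: nD; split; [exact: sub|]].
have : (connected_component Omega w `&` A) w.
  by rewrite ccA; exact: connected_component_refl.
by case=> _ [].
Qed.

Lemma eval_continuous_derive1n k w : F !=set0 -> Omega w -> eval_continuous k w.
Proof.
move=> [j0 Fj0] ow.
have exF : exists n, `[< F n >] by exists j0; apply/asboolP.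
have [m /asboolP Fm mmin] := ex_minnP exF.
have minF j : F j -> (m <= j)%N by move=> /asboolP/mmin.
have up d z : Omega z -> eval_equicontinuous (m + d) z.
  elim: d => [|d IH] oz; first by rewrite addn0; exact: eval_equicontinuous_sup.
  by rewrite addnS; apply: eval_equicontinuous_succ => //; exact: IH.
have down d z : Omega z -> eval_equicontinuous (m - d) z.
  elim: d z => [|d IH] z oz; first by rewrite subn0; exact: eval_equicontinuous_sup.
  (* Subtraction is truncated: once [m <= d], the orders [m - d] and [m - d.+1] are both 0. *)
  have [md|dm] := leqP m d.
    by have := IH _ oz; rewrite (eqP (leqW md : (m - d.+1 == 0)%N)) (eqP (md : (m - d == 0)%N)).
  apply: eval_equicontinuous_pred oz; last by rewrite -subSn // subSS.
  by move=> j /minF; apply: leq_trans; rewrite -subSn // subSS leq_subr.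
apply: eval_equicontinuousW.
have [km|mk] := leqP k m.
  by rewrite -(subKn km); exact: down.
by rewrite -(subnKC (ltnW mk)); exact: up.
Qed.

End Components.

(** * Small multiples of a fixed function, measured by finitely many seminorms *)

Section Perturbation.
Context {R : realType}.
Variables (Omega : set (Cplx R)) (F I : set nat) (pt : nat -> Cplx R).
Hypothesis Omega_open : open Omega.

(** This is homogeneity of the seminorms in the direction [h]. The summand 0 brings the function
    into the shape of [derive1n_add_scale]. *)
Lemma seminorm_scale_bound (p : (Cplx R -> Cplx R) -> R) (h : Cplx R -> Cplx R) w :
  Omega w -> HFinfty_set Omega F h -> (forall i, I i -> Omega (pt i)) ->
  HFinfty_seminorms Omega F I pt p ->
  exists B : R, forall t : R, 0 < t -> p (fun z => 0 + (Complex t 0 : Cplx R) * h z) <= t * B.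
Proof.
move=> ow [hh h0 bh] ptO.
have hol0 : holomorphic_on Omega (fun=> 0).
  by move=> z oz; have [] := is_derive_cst 0 z.
have d0 k z : Omega z -> derive1n k (fun=> 0 : Cplx R) z = 0.
  (* The zero function equals 0 + (-1) * 0, so by linearity its derivative has the form d - d. *)
  move=> oz; have := derive1n_add_scale Omega_open (-1) k hol0 hol0 oz.
  rewrite [in RHS]mulN1r [RHS]subrr => E; rewrite -[RHS]E.
  by congr (derive1n _ _ _); apply/funext => y; rewrite mulr0 addr0.
have scale k z (t : R) : 0 < t -> Omega z ->
    cmod (derive1n k (fun z => 0 + (Complex t 0 : Cplx R) * h z) z) = t * cmod (derive1n k h z).
  move=> t0 oz; rewrite (derive1n_add_scale Omega_open _ _ hol0 hh oz) d0 // add0r.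
  by rewrite cmodM cmod_real gtr0_norm.
move=> [[k Fk ->]|[i [k [Ii _ ->]]]]; last first.
  exists (cmod (derive1n k h (pt i))) => t t0.
  by rewrite /point_seminorm scale //; exact: ptO.
have [M hM] := (bounded_cmodP _ _).1 (bh _ Fk).
exists M => t t0; apply: sup_seminorm_le ow _ => z oz.
by rewrite scale // ler_wpM2l ?(ltW t0) //; exact: hM.
Qed.

Lemma finite_uniform_bound (T : choiceType) (S : set T) (Q : T -> R -> Prop) :
  finite_set S -> (forall p B B', B <= B' -> Q p B -> Q p B') ->
  (forall p, S p -> exists B, Q p B) -> exists B, forall p, S p -> Q p B.
Proof.
move=> /finite_seqP[s ->] Qm; elim: s => [|x s IH] H; first by exists 0.
have [|B sB] := IH; first by move=> p ps; apply: H; rewrite /= inE (ps : p \in s) orbT.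
have [|B' xB'] := H x; first by rewrite /= inE eqxx.
exists (Num.max B B') => p /=; rewrite inE => /predU1P[->|ps].
  by apply: Qm xB'; rewrite le_max lexx orbT.
by apply: Qm (sB p ps); rewrite le_max lexx.
Qed.

End Perturbation.

Theorem theorem7p2 (R : realType) (Omega : set (Cplx R)) (F : set nat) (l : nat)
    (I : set nat) (Omega_ : nat -> set (Cplx R)) (z : nat -> Cplx R)
    (Omega_open : open Omega) (F_neq0 : F !=set0)
    (Omega_comp : components_indexed Omega I Omega_)
    (z_in : forall i, I i -> Omega_ i (z i)) :
  (forall f : HFinfty Omega F I z,
     [bounded derive1n l (HFinfty_fun f) w | w in Omega])
  \/ generically (fun f : HFinfty Omega F I z =>
       ~ [bounded derive1n l (HFinfty_fun f) w | w in Omega]).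
Proof.
have [[h hunb]|] := pselect (exists h : HFinfty Omega F I z,
    ~ [bounded derive1n l (HFinfty_fun h) w | w in Omega]); last first.
  by move=> /forallNP H; left => f; apply: contrapT; exact: H.
right.
have HFP (f : HFinfty Omega F I z) : HFinfty_set Omega F (HFinfty_fun f) := proj2_sig f.
have HF_h := HFP h.
have ptO i : I i -> Omega (z i).
  move=> Ii; have [_ _ comps] := Omega_comp.
  have : [set connected_component Omega w | w in Omega] (Omega_ i) by rewrite -comps; exists i.
  by move=> [w _ E]; apply: (@connected_component_sub _ Omega w); rewrite E; exact: z_in.
(* On an empty set every function is bounded, contrary to [hunb]. The point [w0] keeps the suprema
   in the seminorms over non-empty sets. *)
have [w0 ow0] : Omega !=set0.
  apply/set0P/eqP => O0; apply: hunb; apply/bounded_cmodP; exists 0 => w ow.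
  by have : (set0 : set (Cplx R)) w by rewrite -O0.
exists [set f : HFinfty Omega F I z | ~ [bounded derive1n l (HFinfty_fun f) w | w in Omega]].
split=> //.
- exists (fun n => [set f : HFinfty Omega F I z | exists2 w, Omega w &
      n%:R < cmod (derive1n l (HFinfty_fun f) w)]).
    move=> n; rewrite -[open _]/(HFinfty_open _) => f [w ow fw].
    have [S [C [fS sS dom]]] := eval_continuous_derive1n Omega_open Omega_comp z_in l F_neq0 ow.
    set d := cmod _ in fw.
    have C1 : 0 < `|C| + 1 by rewrite ltr_wpDl.
    (* This radius makes the change of the [l]-th derivative at [w] smaller than [d - n%:R], the
       margin by which [f] satisfies the strict inequality. *)
    have e0 : 0 < (d - n%:R) / (`|C| + 1) by rewrite divr_gt0 // subr_gt0.
    exists S, ((d - n%:R) / (`|C| + 1)); split=> // g gS.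
    exists w => //.
    have [hf _ _] := HFP f; have [hg _ _] := HFP g.
    have E : HFinfty_fun g \- HFinfty_fun f = (fun z => HFinfty_fun g z + -1 * HFinfty_fun f z).
      by apply/funext => x; rewrite mulN1r.
    rewrite E in gS.
    have := dom _ _ (HFinfty_set_add_scale Omega_open (-1) (HFP g) (HFP f)) e0 gS.
    rewrite (derive1n_add_scale Omega_open (-1) l hg hf ow) mulN1r.
    have lt : C * ((d - n%:R) / (`|C| + 1)) < d - n%:R.
      apply: le_lt_trans (_ : `|C| * ((d - n%:R) / (`|C| + 1)) < _).
        by rewrite ler_wpM2r ?ler_norm // ltW.
      by rewrite mulrCA gtr_pMr ?subr_gt0 // ltr_pdivrMr // mul1r ltrDl.
    have := cmodD (derive1n l (HFinfty_fun f) w - derive1n l (HFinfty_fun g) w)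
      (derive1n l (HFinfty_fun g) w).
    rewrite subrK cmodB -/d; move: lt; set u := cmod (_ - _); lra.
  apply/seteqP; split => f /=.
    move=> unb n _; apply: contrapT => nw; apply: unb; apply/bounded_cmodP.
    exists n%:R => w ow; rewrite leNgt; apply/negP => lt; apply: nw.
    by exists w.
  move=> H /bounded_cmodP[M fM].
  have [w ow] := H (Num.truncn M).+1 Logic.I.
  by apply/negP; rewrite -leNgt; apply: le_trans (fM w ow) _; exact/ltW/truncnS_gt.
- move=> O [f Of] oO.
  have [bf|] := pselect [bounded derive1n l (HFinfty_fun f) w | w in Omega]; last first.
    by exists f.
  have [S [e [fS sS e0 SO]]] := oO f Of.
  have [B HB] := finite_uniform_bound (Q := fun p B => forall t : R, 0 < t ->
      p (fun z => 0 + (Complex t 0 : Cplx R) * HFinfty_fun h z) <= t * B) fS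
    (fun p B B' BB' H t t0 => le_trans (H t t0) (ler_wpM2l (ltW t0) BB'))
    (fun p Sp => seminorm_scale_bound Omega_open ow0 HF_h ptO (sS p Sp)).
  have B1 : 0 < `|B| + 1 by rewrite ltr_wpDl.
  (* With this choice [t * B < e], so the perturbed function stays in the basic neighborhood inside
     [O]. *)
  pose t := e / (`|B| + 1).
  have t0 : 0 < t by rewrite divr_gt0.
  pose c : Cplx R := Complex t 0.
  pose g : HFinfty Omega F I z := exist _ _ (HFinfty_set_add_scale Omega_open c (HFP f) HF_h).
  exists g; split.
    apply: SO => p Sp.
    have -> : HFinfty_fun g \- HFinfty_fun f = (fun z => 0 + c * HFinfty_fun h z).
      by apply/funext => x; rewrite /= addrAC subrr.
    apply: le_lt_trans (HB p Sp t t0) _.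
    apply: le_lt_trans (_ : t * `|B| < e); first by rewrite ler_wpM2l ?ler_norm // ltW.
    by rewrite /t -mulrA gtr_pMr // mulrC ltr_pdivrMr // mul1r ltrDl.
  (* Otherwise [t] times the [l]-th derivative of [h], being the difference of those of [g] and [f],
     would be bounded by [M + N]. *)
  move=> /bounded_cmodP[M gM]; have [N fN] := (bounded_cmodP _ _).1 bf.
  apply: hunb; apply/bounded_cmodP; exists ((M + N) / t) => w ow.
  have [hf _ _] := HFP f; have [hh _ _] := HF_h.
  rewrite ler_pdivlMr // mulrC -[t](gtr0_norm t0) -cmod_real -cmodM.
  have := gM w ow; have := fN w ow.
  have := derive1n_add_scale Omega_open c l hf hh ow.
  rewrite -[fun z => _]/(HFinfty_fun g) => ->.
  set u := derive1n l _ w; set v := c * _ => h1 h2.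
  have := cmodD (u + v) (- u); rewrite addrAC subrr add0r cmodN; lra.
Qed.
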